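(* For every fixed integer $p\ge 3$, $$f_{p+1}(n,m)=\Phi_p(\lambda)\,n^2+O_p(n)\qquad\text{for all integers } n\ge 1 \text{ and } m \text{ with } t_{p-1}(n)<m\le t_p(n),$$ where $\lambda=\dfrac{m-t_{p-1}(n)}{t_p(n)-t_{p-1}(n)}\in(0,1]$.
   Context: All graphs are finite and simple. For a $K_{p+1}$-free graph $G$, a non-edge $xy$ (an unordered pair of distinct non-adjacent vertices) is $K_{p+1}$-saturating if $G+xy$ contains a copy of $K_{p+1}$. $f_{p+1}(G)$ is the number of $K_{p+1}$-saturating non-edges of $G$, and $f_{p+1}(n,m)$ is the minimum of $f_{p+1}(G)$ over all $K_{p+1}$-free graphs $G$ with $n$ vertices and $m$ edges. $T_r(n)$ is the complete balanced $r$-partite graph on $n$ vertices and $t_r(n)=e(T_r(n))$ is its number of edges. Let $D_p=4p^2-11p+8$. For $\lambda\in(0,1]$, $x_p(\lambda)$ is the unique positive root $x$ of $$p^3D_px^4-2p^2(p-2)^2x^3-2p(p-2)\lambda x-\lambda^2=0,$$ and $$y_p(\lambda)=\frac{\lambda}{2p(p-1)x_p(\lambda)}+\frac{p-2}{p-1}\left(1-\frac{x_p(\lambda)}2\right),\qquad \Phi_p(\lambda)=\frac12\left(x_p(\lambda)^2+\frac{y_p(\lambda)^2}{p-1}\right).$$ $O_p(n)$ denotes a quantity bounded in absolute value by $C_p n$, where the constant $C_p$ depends only on $p$ (uniformly in $n$ and $m$). *)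

(* Defs.v *)
From HB Require Import structures.
From mathcomp Require Import all_boot all_order all_algebra.
From mathcomp Require Import boolp classical_sets reals.
From mathcomp Require Import zify ring lra.

Set Implicit Arguments.
Unset Strict Implicit.
Unset Printing Implicit Defensive.

Import Order.TTheory GRing.Theory Num.Theory.

(* A simple graph on the vertex set V is given by its set of edges, which is a
   set of 2-element subsets of V. *)
Section Graphs.
Variable V : finType.
Implicit Types (E : {set {set V}}) (S : {set V}) (k : nat).

Definition pairs : {set {set V}} := [set e : {set V} | #|e| == 2].

Definition simple_graph E : bool := E \subset pairs.

Definition nonedges E : {set {set V}} := pairs :\: E.

Definition clique E S : bool := [forall e in pairs, (e \subset S) ==> (e \in E)].

Definition contains_K k E : bool := [exists S : {set V}, (#|S| == k) && clique E S].

Definition K_free k E : bool := ~~ contains_K k E.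

Definition saturating k E : {set {set V}} :=
  [set e in nonedges E | contains_K k (e |: E)].

Definition fsat k E : nat := #|saturating k E|.

End Graphs.

Definition Kfree_graph (k n m : nat) (E : {set {set 'I_n}}) : bool :=
  [&& simple_graph E, K_free k E & #|E| == m].

(* No graph on n vertices has more than 'C(n, 2) non-edges, so the initial value
   of the iterated minimum only matters when there is no K_k-free graph with n
   vertices and m edges; see fsat_min_le, fsat_min_attained and Kfree_graph_ex. *)
Definition fsat_min (k n m : nat) : nat :=
  \big[minn/'C(n, 2)]_(E : {set {set 'I_n}} | Kfree_graph k m E) fsat k E.

(* The parts are the residue classes modulo r, whose sizes differ by at most 1. *)
Definition turan (r n : nat) : {set {set 'I_n}} :=
  [set [set ij.1; ij.2] | ij : 'I_n * 'I_n & ij.1 %% r != ij.2 %% r].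

Definition t (r n : nat) : nat := #|turan r n|.

Section Profile.
Local Open Scope ring_scope.
Variables (R : realType) (p : nat).

Definition D : R := 4 * p%:R ^+ 2 - 11 * p%:R + 8.

Definition quartic (lam x : R) : R :=
  p%:R ^+ 3 * D * x ^+ 4 - 2 * p%:R ^+ 2 * (p%:R - 2) ^+ 2 * x ^+ 3
  - 2 * p%:R * (p%:R - 2) * lam * x - lam ^+ 2.

(* For 2 < p and 0 < lam <= 1 there is exactly one such root: see xroot_spec and
   xroot_unique. *)
Definition xroot (lam : R) : R :=
  xget 0 [set x : R | 0 < x /\ quartic lam x = 0]%classic.

Definition yroot (lam : R) : R :=
  lam / (2 * p%:R * (p%:R - 1) * xroot lam)
  + (p%:R - 2) / (p%:R - 1) * (1 - xroot lam / 2).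

Definition Phi (lam : R) : R :=
  (xroot lam ^+ 2 + yroot lam ^+ 2 / (p%:R - 1)) / 2.

End Profile.

Lemma fsat_le_bin k n (E : {set {set 'I_n}}) : fsat k E <= 'C(n, 2).
Proof.
rewrite -[n in 'C(n, _)]card_ord -card_draws; apply: subset_leq_card.
by apply/fintype.subsetP => e; rewrite !inE => /andP[/andP[]].
Qed.

Lemma fsat_min_le k n m (E : {set {set 'I_n}}) :
  Kfree_graph k m E -> fsat_min k n m <= fsat k E.
Proof. by move=> h; rewrite -leEnat /fsat_min -minEnat; apply: bigmin_le_cond. Qed.

Lemma fsat_min_attained k n m (E0 : {set {set 'I_n}}) : Kfree_graph k m E0 ->
  exists2 E : {set {set 'I_n}}, Kfree_graph k m E & fsat k E = fsat_min k n m.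
Proof.
move=> h; rewrite /fsat_min -minEnat.
have [|E hE ->] := @eq_bigmin _ _ _ 'C(n, 2) E0 _ (@fsat _ k) h.
  by move=> E _; rewrite leEnat fsat_le_bin.
by exists E.
Qed.

Lemma turanE r n (i j : 'I_n) : ([set i; j] \in turan r n) = (i %% r != j %% r).
Proof.
apply/imsetP/idP => [[[a b]]|h]; last by exists (i, j); rewrite ?inE.
rewrite inE /= => hab eq_ab.
have : (a \in [set i; j]) && (b \in [set i; j]) by rewrite eq_ab !inE !eqxx orbT.
rewrite !inE => /andP[/orP[]/eqP ha /orP[]/eqP hb]; move: hab;
  by rewrite ha hb ?eqxx // eq_sym.
Qed.

Lemma turan_simple r n : simple_graph (turan r n).
Proof.
apply/fintype.subsetP => e /imsetP[[i j]]; rewrite !inE /= => h ->.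
by rewrite cards2; case: (eqVneq i j) h => // ->; rewrite eqxx.
Qed.

Lemma turan_free r n : 0 < r -> K_free r.+1 (turan r n).
Proof.
move=> r0; apply/existsP => -[S /andP[/eqP cS /forallP cl]].
pose f (i : 'I_n) : 'I_r := Ordinal (ltn_pmod i r0).
have inj : {in S &, injective f}.
  move=> i j iS jS eqf; apply/eqP; apply: contraT => nij.
  have := cl [set i; j]; rewrite inE cards2 nij /= finset.subUset !finset.sub1set iS jS /=.
  by rewrite turanE => /eqP; case; have /= := congr1 val eqf.
by have := max_card (f @: S); rewrite (card_in_imset inj) cS card_ord ltnn.
Qed.

Lemma Kfree_graph_ex r n m : 0 < r -> m <= t r n ->
  exists E : {set {set 'I_n}}, Kfree_graph r.+1 m E.
Proof.
move=> r0 le_m.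
have : 0 < #|[set E : {set {set 'I_n}} | E \subset turan r n & #|E| == m]|.
  by rewrite cards_draws bin_gt0.
case/card_gt0P => E; rewrite inE => /andP[sub cE]; exists E; rewrite /Kfree_graph cE andbT.
rewrite /simple_graph (fintype.subset_trans sub (turan_simple r n)) /=.
apply: contra (turan_free n r0) => /existsP[S /andP[cS /forallP cl]].
apply/existsP; exists S; rewrite cS; apply/forallP => e.
apply/implyP => he; apply/implyP => eS.
by have := cl e; rewrite he eS => /(fintype.subsetP sub).
Qed.

Section Root.
Local Open Scope ring_scope.
Variables (R : realType) (p : nat) (lam : R).
Hypotheses (hp : (2 < p)%N) (lam_gt0 : 0 < lam) (lam_le1 : lam <= 1).

Lemma quartic_root_uniq (x z : R) :
  0 < x -> 0 < z -> quartic p lam x = 0 -> quartic p lam z = 0 -> x = z.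
Proof.
have P2 : 0 < p%:R - 2 :> R by rewrite subr_gt0 ltr_nat.
have P0 : 0 < p%:R :> R by lra.
wlog le_xz : x z / x <= z => [th|] x0 z0 hx hz.
  by have [/th|/ltW/th h] := leP x z; [apply|symmetry; apply: h].
apply/eqP; rewrite eq_le le_xz /= leNgt; apply/negP => lt_xz.
have : quartic p lam z * x ^+ 4 - quartic p lam x * z ^+ 4 =
  (z - x) * (2 * p%:R ^+ 2 * (p%:R - 2) ^+ 2 * (x ^+ 3 * z ^+ 3)
   + 2 * p%:R * (p%:R - 2) * lam * (x * z) * (z ^+ 2 + z * x + x ^+ 2)
   + lam ^+ 2 * ((z + x) * (z ^+ 2 + x ^+ 2))).
  by rewrite /quartic; ring.
rewrite hx hz !mul0r subrr => /esym/eqP; apply/negP; rewrite gt_eqF//.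
rewrite mulr_gt0 ?subr_gt0 //.
by repeat (first [assumption | exact: ltr0Sn | apply: addr_gt0 | apply: mulr_gt0
                 | apply: exprn_gt0]).
Qed.

Lemma quartic_root_ex : exists2 x : R, 0 < x & quartic p lam x = 0.
Proof.
pose q : {poly R} := (p%:R ^+ 3 * D R p) *: 'X^4
  - (2 * p%:R ^+ 2 * (p%:R - 2) ^+ 2) *: 'X^3
  - (2 * p%:R * (p%:R - 2) * lam) *: 'X - (lam ^+ 2)%:P.
have qE x : q.[x] = quartic p lam x by rewrite /q /quartic !hornerE; ring.
have : q.[0] <= 0 <= q.[1].
  rewrite !qE /quartic /D !expr0n /= !mulr0 !expr1n; apply/andP; split.
    by rewrite !subr0 sub0r oppr_le0 sqr_ge0.
  have -> : p%:R = (p - 3)%:R + 3 :> R by rewrite -natrD subnK.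
  have : 0 <= (p - 3)%:R :> R by rewrite ler0n.
  set s := (p - 3)%:R => s0.
  have := mulr_ge0 s0 s0; move: (lam_gt0) (lam_le1) => l0 l1.
  have l2 : lam ^+ 2 <= 1 by rewrite expr_le1 // ltW.
  have h : 0 <= 2 * (s + 3) * (s + 3 - 2) * (1 - lam).
    by rewrite !mulr_ge0 //; lra.
  have h2 : 0 <= s ^+ 2 by rewrite exprn_ge0.
  have h3 : 0 <= s ^+ 3 by rewrite exprn_ge0.
  have h4 : 0 <= s ^+ 4 by rewrite exprn_ge0.
  have h5 : 0 <= s ^+ 5 by rewrite exprn_ge0.
  by lra.
case/(poly_ivt ler01) => x /andP[x0 _] /rootP; rewrite qE => hx; exists x => //.
rewrite lt_neqAle x0 andbT; apply/eqP => x_eq0; move: hx.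
rewrite -x_eq0 /quartic !expr0n /= !mulr0 !subr0 sub0r => /eqP.
by rewrite oppr_eq0 sqrf_eq0 gt_eqF.
Qed.

Lemma xroot_spec : 0 < xroot p lam /\ quartic p lam (xroot p lam) = 0.
Proof.
have [x x0 hx] := quartic_root_ex.
by apply: (@xgetPex _ 0 [set x : R | 0 < x /\ quartic p lam x = 0]%classic); exists x.
Qed.

Lemma xroot_unique (x : R) : 0 < x -> quartic p lam x = 0 -> x = xroot p lam.
Proof. by have [h0 h] := xroot_spec; move=> x0 hx; exact: quartic_root_uniq. Qed.

End Root.

(* Main.v *)
(* Let G be K_{p+1}-free with n vertices and m edges, f = f_{p+1}(G), and let phi
   be a maximum fractional packing of its copies of K_p, every vertex having
   capacity 1.  Write k for the total weight of phi, sigma = 1 - load for the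
   slack, Q for a copy of K_p, and I_q for the common neighbourhood of Q \ q.
   - A vertex u has at most p - 2 neighbours in Q, plus one if it lies in some
     I_q, in which case it is q or forms a saturating pair with q.  Summed against
     phi, this bounds the weight of the saturating pairs meeting the load below
     by that of the edges meeting it minus (p - 2) k (n - p k / 2), up to n / 2.
   - sigma is supported on a K_p-free set, so by Motzkin and Straus the edges
     inside sigma have weight at most (p - 2) / (2 (p - 1)) * (n - p k)^2.
   - By averaging, some Q with phi(Q) > 0 has many edges to sigma.  The I_q are
     disjoint and all pairs inside an I_q are saturating; maximality of phi forces
     one I_q to carry no slack, so Cauchy-Schwarz applies with p - 1 classes.
   With m = (p - 2) / (2 (p - 1)) * (n - k)^2 + k Y these add up to
   2 f + n >= k^2 + Y^2 / (p - 1) when Y >= (p - 1) k, and 2 Phi n^2 is, up to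
   O(n), the minimum of this expression over k.  Turan's theorem gives k >= 1. *)

Require Import Defs.
From HB Require Import structures.
From mathcomp Require Import all_boot all_order all_algebra.
From mathcomp Require Import boolp classical_sets reals.
From mathcomp Require Import topology normedtype derive.
From mathcomp Require Import zify ring lra.

Set Implicit Arguments.
Unset Strict Implicit.
Unset Printing Implicit Defensive.

Import Order.TTheory GRing.Theory Num.Theory.
Import numFieldNormedType.Exports.

(** * Cliques and saturating pairs *)

Section Adjacency.
Variable V : finType.
Implicit Types (E : {set {set V}}) (S Q : {set V}) (u v : V).

Definition adj E u v : bool := [set u; v] \in E.

Lemma adjC E u v : adj E u v = adj E v u.
Proof. by rewrite /adj finset.setUC. Qed.

Lemma adj_irr E u : simple_graph E -> adj E u u = false.
Proof.
move=> sE; apply/negP => /(fintype.subsetP sE).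
by rewrite inE finset.setUid cards1.
Qed.

Lemma cliqueP E S :
  reflect {in S &, forall u v, u != v -> adj E u v} (clique E S).
Proof.
apply: (iffP forallP) => [cl u v uS vS uv|h e].
  have := cl [set u; v]; rewrite inE cards2 uv /= finset.subUset !finset.sub1set.
  by rewrite uS vS.
apply/implyP; rewrite inE => /cards2P[u [v [uv ->]]]; apply/implyP.
by rewrite finset.subUset !finset.sub1set => /andP[uS vS]; apply: h.
Qed.

Lemma cliqueW E S Q : S \subset Q -> clique E Q -> clique E S.
Proof.
move=> /fintype.subsetP SQ /cliqueP cQ; apply/cliqueP => u v uS vS.
by apply: cQ; apply: SQ.
Qed.

Lemma clique_setU1 E u S :
  clique E S -> {in S, forall v, u != v -> adj E u v} -> clique E (u |: S).
Proof.
move=> /cliqueP cS uS; apply/cliqueP => a b /setU1P[->|aS] /setU1P[->|bS].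
- by rewrite eqxx.
- exact: uS.
- by rewrite eq_sym adjC; apply: uS.
- exact: cS.
Qed.

Lemma set2_eq (a b u v : V) : u != v ->
  ([set a; b] == [set u; v]) = ((a, b) == (u, v)) || ((a, b) == (v, u)).
Proof.
move=> uv; rewrite !xpair_eqE; apply/eqP/orP => [h|]; last first.
  by case=> /andP[/eqP -> /eqP ->] //; rewrite finset.setUC.
have : (a \in [set u; v]) && (b \in [set u; v]) by rewrite -h !inE !eqxx orbT.
have : u \in [set a; b] by rewrite h !inE eqxx.
have : v \in [set a; b] by rewrite h !inE eqxx orbT.
rewrite !inE => ha hb /andP[/orP[]/eqP ea /orP[]/eqP eb]; subst a b.
- by move: ha; rewrite eq_sym (negPf uv).
- by rewrite !eqxx; left.
- by rewrite !eqxx; right.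
- by move: hb; rewrite (negPf uv).
Qed.

Lemma sum_adj E : simple_graph E -> \sum_u \sum_v (adj E u v : nat) = (2 * #|E|)%N.
Proof.
move=> sE; rewrite pair_big /= mulnC.
pose g (ij : V * V) := [set ij.1; ij.2].
rewrite (eq_bigr (fun ij : V * V => if g ij \in E then 1 else 0)%N); last first.
  by move=> ij _; rewrite /adj /g; case: ifP.
rewrite -big_mkcond (partition_big g (mem E)) //=.
rewrite -sum_nat_const; apply: eq_bigr => e eE.
have := fintype.subsetP sE _ eE; rewrite inE => /cards2P[u [v [uv e_uv]]].
rewrite sum1_card -(_ : #|[set (u, v); (v, u)]| = 2); last first.
  by rewrite cards2 xpair_eqE (negPf uv).
apply: eq_card => -[a b]; rewrite !inE /g /= e_uv -set2_eq // unfold_in /=.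
by case: eqP => [->|]; rewrite ?andbF // -e_uv eE.
Qed.

Definition cnbr E S : {set V} := [set u | [forall v in S, adj E u v]].

Lemma cnbrP E S u : reflect {in S, forall v, adj E u v} (u \in cnbr E S).
Proof. by rewrite inE; apply: (iffP forall_inP). Qed.

Lemma notin_cnbr E S u : simple_graph E -> u \in cnbr E S -> u \notin S.
Proof. by move=> sE /cnbrP uS; apply/negP => /uS; rewrite adj_irr. Qed.

Lemma clique_cnbr E S u : clique E S -> u \in cnbr E S -> clique E (u |: S).
Proof. by move=> cS /cnbrP uS; apply: clique_setU1 => // v /uS. Qed.

Lemma Kfree_clique k E S : K_free k.+1 E -> clique E S -> #|S| <= k.
Proof.
move=> /existsP kf cS; rewrite leqNgt; apply/negP => ltkS.
have : 0 < #|[set B : {set V} | B \subset S & #|B| == k.+1]|.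
  by rewrite cards_draws bin_gt0.
case/card_gt0P => B; rewrite inE => /andP[BS cB]; apply: kf; exists B.
by rewrite cB (cliqueW BS cS).
Qed.

Lemma sum_adj_lt E S u : u \notin cnbr E S -> \sum_(v in S) (adj E u v : nat) < #|S|.
Proof.
apply: contraNltn => h; apply/cnbrP => v vS; apply: contraT => /negPf nuv.
move: h; rewrite (bigD1 v) //= nuv add0n (cardsD1 v) vS add1n ltnNge -sum1_card.
rewrite [leqRHS](eq_bigl (fun q => (q \in S) && (q != v))) => [|q].
  by rewrite leq_sum // => q _; case: adj.
by rewrite !inE andbC.
Qed.

Variables (E : {set {set V}}) (p : nat).
Hypotheses (sE : simple_graph E) (p_gt0 : 0 < p) (fE : K_free p.+1 E).

(** The diagonal is included so that the relation contains the full square of every common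
    neighbourhood of a clique on [p - 1] vertices; this costs the summand [n] in [wsum_soe_one]. *)
Definition sat_or_eq u v : bool := (u == v) || ([set u; v] \in saturating p.+1 E).

(** If adjacent, [u] and [v] would extend [S] to a clique on [p + 1] vertices; so the pair [uv] is
    all that this clique lacks. *)
Lemma cnbr_sat S u v : clique E S -> #|S| = p.-1 ->
  u \in cnbr E S -> v \in cnbr E S -> sat_or_eq u v.
Proof.
move=> cS szS uS vS; rewrite /sat_or_eq; case: eqVneq => //= uv.
have szvS : #|v |: S| = p by rewrite cardsU1 (notin_cnbr sE vS) szS; case: p p_gt0.
have uvS : u \notin v |: S by rewrite in_setU1 negb_or uv (notin_cnbr sE uS).
have szuvS : #|u |: (v |: S)| = p.+1 by rewrite cardsU1 uvS szvS.
have cvS := clique_cnbr cS vS.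
have adjuv : adj E u v = false.
  apply/negP => auv; have : clique E (u |: (v |: S)).
    by apply: clique_setU1 => // w /setU1P[->|/(cnbrP _ _ _ uS)].
  by move/(Kfree_clique fE); rewrite szuvS ltnn.
rewrite !inE cards2 uv andbT -/(adj E u v) adjuv /=.
apply/existsP; exists (u |: (v |: S)); rewrite szuvS eqxx /=.
have sub (w z : V) : adj E w z -> adj ([set u; v] |: E) w z by rewrite /adj !inE orbC => ->.
apply: clique_setU1 => [|w /setU1P[->|wS] _].
- by apply/cliqueP => w z wS zS wz; apply: sub; apply: (cliqueP _ _ cvS).
- by rewrite /adj !inE eqxx.
- by apply: sub; apply: (cnbrP _ _ _ uS).
Qed.

Variable Q : {set V}.
Hypotheses (cQ : clique E Q) (szQ : #|Q| = p).

Lemma card_clique_rem q : q \in Q -> #|Q :\ q| = p.-1.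
Proof. by move=> qQ; rewrite -szQ (cardsD1 q Q) qQ. Qed.

Lemma mem_cnbr_rem q : q \in Q -> q \in cnbr E (Q :\ q).
Proof.
move=> qQ; apply/cnbrP => v; rewrite !inE => /andP[vq vQ].
by apply: (cliqueP _ _ cQ) => //; rewrite eq_sym.
Qed.

(** For [q != r] the sets [Q :\ q] and [Q :\ r] cover [Q], so a vertex in both neighbourhoods would
    extend [Q]. *)
Lemma cnbr_rem_disjoint q r u : q \in Q -> r \in Q ->
  u \in cnbr E (Q :\ q) -> u \in cnbr E (Q :\ r) -> q = r.
Proof.
move=> qQ rQ /cnbrP uq /cnbrP ur; apply/eqP; apply: contraT => qr.
have uQ : u \in cnbr E Q.
  apply/cnbrP => v vQ; have [->|vq] := eqVneq v q.
    by apply: ur; rewrite !inE qr.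
  by apply: uq; rewrite !inE vq.
have := Kfree_clique fE (clique_cnbr cQ uQ).
by rewrite cardsU1 (notin_cnbr sE uQ) szQ ltnn.
Qed.

Lemma sum_adj_clique_lt u : \sum_(q in Q) (adj E u q : nat) <= p.-1.
Proof.
rewrite -ltnS prednK // -[ltnRHS]szQ; apply: sum_adj_lt; apply/negP => uQ.
have := Kfree_clique fE (clique_cnbr cQ uQ).
by rewrite cardsU1 (notin_cnbr sE uQ) szQ ltnn.
Qed.

(** More than [p - 1] neighbours are impossible, and a vertex with exactly [p - 1] misses a single
    [q], hence is joined to all of [Q :\ q]. *)
Lemma sum_adj_clique_le u : \sum_(q in Q) (adj E u q : nat) <=
  p.-2 + \sum_(q in Q) (u \in cnbr E (Q :\ q) : nat).
Proof.
have := sum_adj_clique_lt u; rewrite leq_eqVlt => /orP[/eqP h|]; last first.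
  by move=> h; apply: leq_trans (leq_addr _ _); case: p h => [|[]].
have [q /andP[qQ nuq]] : exists q, (q \in Q) && ~~ adj E u q.
  apply/existsP; apply: contraT; rewrite negb_exists => /forallP hQ.
  have : \sum_(q in Q) (adj E u q : nat) = p.
    rewrite -szQ -sum1_card; apply: eq_bigr => q qQ.
    by have := hQ q; rewrite qQ /= negbK => ->.
  by rewrite h => /eqP; case: p p_gt0 => // k _; rewrite /= ltn_eqF.
have uq : u \in cnbr E (Q :\ q).
  apply/cnbrP => v; rewrite !inE => /andP[vq vQ]; apply: contraT => /negPf nuv.
  move: h; rewrite (bigD1 q) //= (negPf nuq) add0n (bigD1 v) /= ?vQ // nuv add0n => h.
  suff : p.-1 <= p.-2.
    by rewrite -szQ (cardsD1 q) qQ (cardsD1 v) !inE vq vQ /= ltnn.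
  rewrite -[leqLHS]h -szQ (cardsD1 q) qQ (cardsD1 v) !inE vq vQ /= -sum1_card.
  rewrite [leqRHS](eq_bigl (fun w => (w \in Q) && (w != q) && (w != v))) => [|w].
    by rewrite leq_sum // => w _; case: adj.
  by rewrite !inE andbC [(w != q) && _]andbC.
rewrite h (bigD1 q qQ) /= uq addnA.
by apply: leq_trans (leq_addr _ _); case: (p) => [|[]] //= k; rewrite addn1.
Qed.

End Adjacency.

(** * Turan graphs and their numbers of edges *)

Section Turan.
Variable r : nat.
Hypothesis r_gt0 : 0 < r.

Lemma double_t n : 2 * t r n = \sum_(i < n) \sum_(j < n) (i %% r != j %% r).
Proof.
rewrite -(sum_adj (turan_simple r n)); apply: eq_bigr => i _.
by apply: eq_bigr => j _; rewrite /adj turanE.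
Qed.

Lemma sum_neq_mod a s c : s <= r -> s.-1 <= \sum_(j < s) (c != (a + j) %% r).
Proof.
move=> sr; case: (boolP [exists j : 'I_s, c == (a + j) %% r]) => [/existsP[j /eqP cj]|].
  rewrite (bigD1 j) //= (eq_bigr (fun=> 1)) => [|i ij].
    apply: leq_trans (leq_addl _ _).
    by rewrite sum1_card (eq_card (B := predC1 j)) // cardC1 card_ord.
  rewrite cj eqn_modDl !modn_small ?(leq_trans (ltn_ord _)) //.
  by rewrite eq_sym (_ : (i == j :> nat) = false) //; apply/negbTE.
rewrite negb_exists => /forallP h.
rewrite (eq_bigr (fun=> 1)) => [|j _]; last by rewrite h.
by rewrite sum1_card card_ord leq_pred.
Qed.

(** A window of [s <= r] consecutive indices meets each residue class at most once, so every vertex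
    is joined to at least [s.-1] of it. Both [turan_theorem] and [t_ge] induct by removing such a
    window. *)
Lemma t_step a s : s <= r ->
  2 * t r a + 2 * (a * s.-1) + s * s.-1 <= 2 * t r (a + s).
Proof.
move=> sr; rewrite !double_t.
have split (F : nat -> nat) : \sum_(j < a + s) F j = \sum_(j < a) F j + \sum_(j < s) F (a + j).
  by rewrite big_split_ord.
rewrite (split (fun i => \sum_(j < a + s) (i %% r != j %% r))).
rewrite (eq_bigr _ (fun (i : 'I_a) _ => split (fun j => i %% r != j %% r))).
rewrite (eq_bigr _ (fun (i : 'I_s) _ => split (fun j => (a + i) %% r != j %% r))).
rewrite !big_split /=.
have h1 : a * s.-1 <= \sum_(i < a) \sum_(j < s) (i %% r != (a + j) %% r).
  rewrite -[a in a * _]card_ord -sum_nat_const; apply: leq_sum => i _.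
  exact: sum_neq_mod.
have h2 : s * s.-1 <= \sum_(i < s) \sum_(j < s) ((a + i) %% r != (a + j) %% r).
  rewrite -[X in X * _]card_ord -sum_nat_const; apply: leq_sum => i _.
  exact: sum_neq_mod.
have h3 : \sum_(i < s) \sum_(j < a) ((a + i) %% r != j %% r) =
    \sum_(i < a) \sum_(j < s) (i %% r != (a + j) %% r).
  by rewrite exchange_big; apply: eq_bigr => i _; apply: eq_bigr => j _; rewrite eq_sym.
have add_le (A B C X Y : nat) : X <= B -> Y <= C -> A + 2 * X + Y <= A + B + (B + C).
  lia.
by rewrite h3; apply: add_le.
Qed.

Section TuranTheorem.
Variables (V : finType) (E : {set {set V}}).
Hypotheses (sE : simple_graph E) (fE : K_free r.+1 E).

(** Induction on [#|U|], removing a largest clique [Q] of [U]: by maximality every vertex of [U]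
    misses one of [Q], so the loss is at most what [t_step] grants with [s = #|Q| <= r]. *)
Let sum_adj_le (U : {set V}) : \sum_(u in U) \sum_(v in U) (adj E u v : nat) <= 2 * t r #|U|.
Proof.
have [k] := ubnP #|U|; elim: k U => // k IH U; rewrite ltnS => le_k.
have [->|/set0Pn[u0 u0U]] := eqVneq U finset.set0; first by rewrite big_set0.
pose cl S := clique E S && (S \subset U).
have c1 : cl [set u0].
  rewrite /cl finset.sub1set u0U andbT; apply/cliqueP => v w.
  by rewrite !inE => /eqP -> /eqP ->; rewrite eqxx.
case: (@arg_maxnP _ [set u0] cl (fun S => #|S|) c1) => Q /andP[cQ QU] maxQ.
have s1 : 0 < #|Q| by have /= := maxQ _ c1; rewrite cards1.
have sr : #|Q| <= r := Kfree_clique fE cQ.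
have deg u : u \in U -> \sum_(q in Q) (adj E u q : nat) <= #|Q|.-1.
  move=> uU; rewrite -ltnS prednK //; apply: sum_adj_lt; apply/negP => uQ.
  have := maxQ (u |: Q); rewrite /cl clique_cnbr // finset.subUset finset.sub1set uU QU.
  by move=> /(_ isT) /=; rewrite cardsU1 (notin_cnbr sE uQ) add1n ltnn.
have szU : #|U| = #|U :\: Q| + #|Q| by rewrite cardsD (finset.setIidPr QU) subnK ?subset_leq_card.
have splitU (F : V -> nat) : \sum_(u in U) F u = \sum_(u in U :\: Q) F u + \sum_(u in Q) F u.
  rewrite (bigID (mem Q)) /= addnC; congr (_ + _); apply: eq_bigl => u.
    by rewrite !inE andbC.
  by apply/andP/idP => [[]//|uQ]; rewrite uQ (fintype.subsetP QU).
have lt_k : #|U :\: Q| < k by rewrite szU in le_k; lia.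
have h1 := IH _ lt_k.
have h2 : \sum_(u in U :\: Q) \sum_(v in Q) (adj E u v : nat) <= #|U :\: Q| * #|Q|.-1.
  by rewrite -sum_nat_const; apply: leq_sum => u; rewrite !inE => /andP[_ uU]; apply: deg.
have h3 : \sum_(u in Q) \sum_(v in Q) (adj E u v : nat) <= #|Q| * #|Q|.-1.
  by rewrite -sum_nat_const; apply: leq_sum => u uQ; apply/deg/(fintype.subsetP QU).
have h4 : \sum_(u in Q) \sum_(v in U :\: Q) (adj E u v : nat) =
    \sum_(u in U :\: Q) \sum_(v in Q) (adj E u v : nat).
  by rewrite exchange_big; apply: eq_bigr => u _; apply: eq_bigr => v _; rewrite adjC.
have := t_step #|U :\: Q| sr; rewrite -szU => h5.
have add_le (A B C X Y N M : nat) : A <= N -> B <= X -> C <= Y ->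
  N + 2 * X + Y <= M -> A + B + (B + C) <= M by lia.
rewrite splitU !(eq_bigr _ (fun u _ => splitU _)) !big_split /= h4.
exact: add_le h1 h2 h3 h5.
Qed.

Lemma turan_theorem : #|E| <= t r #|V|.
Proof.
rewrite -(leq_pmul2l (isT : 0 < 2)) -(sum_adj sE) -cardsT.
apply: leq_trans (sum_adj_le _); rewrite leq_eqVlt; apply/orP; left; apply/eqP.
by apply: eq_big => [u|u _]; rewrite ?inE //; apply: eq_bigl => v; rewrite inE.
Qed.

End TuranTheorem.

End Turan.

(** * Graphs with few saturating pairs *)

(** A pair that saturates [E] cannot be an edge of [F], since [F] would then contain the clique it
    completes; so it saturates [F] too. Hence deleting surplus edges is harmless in the upper
    bound. *)
Lemma fsat_mono (V : finType) k (E F : {set {set V}}) :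
  E \subset F -> K_free k F -> fsat k E <= fsat k F.
Proof.
move=> EF fF; apply: subset_leq_card; apply/fintype.subsetP => e.
have sub : e |: E \subset e |: F by rewrite finset.setUS.
rewrite !inE => /andP[/andP[eE ->]] /existsP[S /andP[szS /forallP cS]].
have cF : contains_K k (e |: F).
  apply/existsP; exists S; rewrite szS; apply/forallP => e'.
  apply/implyP => e2; apply/implyP => eS; apply: (fintype.subsetP sub).
  by have := cS e'; rewrite e2 eS.
rewrite cF !andbT; apply: contra fF => eF; move: cF.
by rewrite (finset.setUidPr _) // finset.sub1set.
Qed.

Lemma fsat_add_card_le k n (E : {set {set 'I_n}}) :
  simple_graph E -> fsat k E + #|E| <= 'C(n, 2).
Proof.
move=> sE; have szP : #|pairs 'I_n| = 'C(n, 2) by rewrite card_draws card_ord.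
rewrite -szP -(subnK (subset_leq_card sE)) leq_add2r.
rewrite -[#|E|](_ : #|pairs 'I_n :&: E| = _); last by rewrite (finset.setIidPr sE).
by rewrite -cardsD; apply: subset_leq_card; apply/fintype.subsetP => e; rewrite !inE => /andP[].
Qed.

Lemma sum_lt_ord n b (F : nat -> nat) : b <= n ->
  \sum_(i < n) (i < b) * F i = \sum_(i < b) F i.
Proof.
move=> bn; rewrite (big_ord_widen _ _ bn) [RHS]big_mkcond; apply: eq_bigr => i _.
by case: ltnP => _; rewrite ?mul1n ?mul0n.
Qed.

Lemma sum_ge_ord n k : k <= n -> \sum_(i < n) (n - k <= i : nat) = k.
Proof.
move=> kn; have : \sum_(i < n) ((i < n - k) * 1 + (n - k <= i)) = n.
  rewrite (eq_bigr (fun=> 1)) ?sum1_card ?card_ord // => i _.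
  by rewrite muln1; case: leqP.
rewrite big_split /= (@sum_lt_ord _ _ (fun=> 1)) ?leq_subr // sum1_card card_ord.
lia.
Qed.

(* The vertices below [n - k] carry the Turan graph with [r] parts; each of the
   last [k] vertices is joined to each of the first [b]. *)
Section Construction.
Variables (n k b r : nat).
Hypotheses (r_gt0 : 0 < r) (kbn : k + b <= n).

Let h := n - k.

Let bh : b <= h. Proof. by rewrite /h; lia. Qed.

Definition profile_adj (i j : nat) : bool :=
  [|| [&& i < h, j < h & i %% r != j %% r], (i < b) && (h <= j) | (j < b) && (h <= i)].

Definition profile_graph : {set {set 'I_n}} :=
  [set e in pairs 'I_n | [forall u in e, forall v in e, (u != v) ==> profile_adj u v]].

Let profile_adjC i j : profile_adj i j = profile_adj j i.
Proof.
rewrite /profile_adj eq_sym andbA [(i < h) && (j < h)]andbC -andbA.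
by rewrite [_ && (h <= j) || _]orbC.
Qed.

Let profile_adj_irr i : profile_adj i i = false.
Proof. by rewrite /profile_adj eqxx !andbF /= orbb; apply/negP => /andP[]; lia. Qed.

Lemma profile_simple : simple_graph profile_graph.
Proof. by apply/fintype.subsetP => e; rewrite inE => /andP[]. Qed.

Lemma profile_graphE (u v : 'I_n) : adj profile_graph u v = profile_adj u v.
Proof.
rewrite /adj inE inE cards2; case: (eqVneq u v) => [->|uv] /=.
  by rewrite profile_adj_irr.
apply/forall_inP/idP => [/(_ u)|a_uv w].
  rewrite !inE eqxx => /(_ isT)/forall_inP/(_ v).
  by rewrite !inE eqxx orbT uv => /(_ isT).
rewrite !inE => /orP[]/eqP ->; apply/forall_inP => z; rewrite !inE => /orP[]/eqP ->;
  by rewrite ?eqxx ?uv // profile_adjC ?a_uv ?implybT.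
Qed.

Lemma card_profile_graph : #|profile_graph| = t r (n - k) + k * b.
Proof.
apply/eqP; rewrite -(eqn_pmul2l (isT : 0 < 2)) -(sum_adj profile_simple).
have -> : 2 * (t r (n - k) + k * b) =
    \sum_(i < n) \sum_(j < n) ((i < h) * ((j < h) * (i %% r != j %% r))) +
    (\sum_(i < n) \sum_(j < n) ((i < b) * (h <= j)) +
     \sum_(i < n) \sum_(j < n) ((j < b) * (h <= i))).
  have kn : k <= n by lia.
  have hn : h <= n by rewrite /h leq_subr.
  have bn : b <= n by lia.
  have -> : \sum_(i < n) \sum_(j < n) ((i < h) * ((j < h) * (i %% r != j %% r))) = 2 * t r h.
    rewrite -(sum_adj (turan_simple r h)).
    rewrite (eq_bigr (fun i : 'I_n => (i < h) * \sum_(j < h) (i %% r != j %% r))) => [|i _].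
      rewrite (@sum_lt_ord _ _ (fun i => \sum_(j < h) (i %% r != j %% r))) //.
      by apply: eq_bigr => i _; apply: eq_bigr => j _; rewrite /adj turanE.
    by rewrite -big_distrr /= (@sum_lt_ord _ _ (fun j => i %% r != j %% r)).
  have e1 : \sum_(i < n) \sum_(j < n) ((i < b) * (h <= j)) = b * k.
    rewrite (eq_bigr (fun i : 'I_n => (i < b) * k)) => [|i _].
      by rewrite (@sum_lt_ord _ _ (fun=> k)) // sum_nat_const card_ord.
    by rewrite -big_distrr /= sum_ge_ord.
  have e2 : \sum_(i < n) \sum_(j < n) ((j < b) * (h <= i)) = b * k.
    by rewrite exchange_big.
  by rewrite e1 e2 /h; lia.
rewrite -!big_split; apply/eqP/eq_bigr => i _ /=; rewrite -!big_split.
apply: eq_bigr => j _ /=; rewrite profile_graphE /profile_adj.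
have := bh; case: (ltnP i h); case: (ltnP j h); case: (ltnP i b); case: (ltnP j b);
  case: (_ == _) => //=; lia.
Qed.

(** A proper colouring with [r + 1] colours: the residue below [h], and the extra colour [r] on the
    last [k] vertices. *)
Let color (u : 'I_n) : 'I_r.+1 := inord (if h <= u then r else u %% r).

Let colorE u : color u = (if h <= u then r else u %% r) :> nat.
Proof. by rewrite inordK //; case: ifP => // _; rewrite ltnS ltnW // ltn_pmod. Qed.

Let color_adj (u v : 'I_n) : profile_adj u v -> color u != color v.
Proof.
apply: contraTneq => /(congr1 (@nat_of_ord _)); rewrite !colorE /profile_adj.
have := ltn_pmod u r_gt0; have := ltn_pmod v r_gt0; have := bh.
case: (ltnP u h); case: (ltnP v h); case: (ltnP u b); case: (ltnP v b);
  case: eqP => //=; lia.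
Qed.

Lemma profile_free : K_free r.+2 profile_graph.
Proof.
apply/existsP => -[S /andP[/eqP szS /cliqueP cS]].
have inj : {in S &, injective color}.
  move=> u v uS vS cuv; apply/eqP; apply: contraT => uv.
  by have := cS u v uS vS uv; rewrite profile_graphE => /color_adj; rewrite cuv eqxx.
by have := max_card (color @: S); rewrite (card_in_imset inj) szS card_ord ltnn.
Qed.

(** If [uv] completes a clique [S] on [r + 2] vertices, then [S :\ u] is a clique of the graph and
    uses every colour once. The vertex of it coloured like [u] is not adjacent to [u], so it is
    [v]. *)
Let saturating_color (u v : 'I_n) : [set u; v] \in saturating r.+2 profile_graph ->
  ((h <= u) && (h <= v)) || [&& u < b, v < b & u %% r == v %% r].
Proof.
rewrite !inE => /andP[/andP[nuv]]; rewrite cards2; case: (eqVneq u v) => // uv _.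
case/existsP => S /andP[/eqP szS /cliqueP cS].
have cS' s w : s \in S -> w \in S -> s != w -> [set s; w] != [set u; v] ->
    profile_adj s w.
  move=> sS wS sw ne; have := cS s w sS wS sw.
  by rewrite /adj in_setU1 (negPf ne) /= -/(adj profile_graph s w) profile_graphE.
have uS : u \in S.
  apply: contraT => uS; have : contains_K r.+2 profile_graph.
    apply/existsP; exists S; rewrite szS eqxx; apply/cliqueP => s w sS wS sw.
    rewrite profile_graphE cS' //; apply: contra uS => /eqP e.
    have : u \in [set s; w] by rewrite e !inE eqxx.
    by rewrite !inE => /orP[]/eqP ->.
  by rewrite (negPf profile_free).
have inj : {in S :\ u &, injective color}.
  move=> s w; rewrite !inE => /andP[su sS] /andP[wu wS] csw.
  apply/eqP; apply: contraT => sw.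
  have /color_adj : profile_adj s w.
    apply: cS' => //; apply/eqP => e.
    have : u \in [set s; w] by rewrite e !inE eqxx.
    by rewrite !inE ![u == _]eq_sym (negPf su) (negPf wu).
  by rewrite csw eqxx.
have full : color @: (S :\ u) = [set: 'I_r.+1].
  apply/eqP; rewrite eqEcard finset.subsetT cardsT card_ord (card_in_imset inj).
  by have := cardsD1 u S; rewrite uS szS add1n => -[->] /=.
have vS : v \in S.
  apply: contraT => vS; have : contains_K r.+2 profile_graph.
    apply/existsP; exists S; rewrite szS eqxx; apply/cliqueP => s w sS wS sw.
    rewrite profile_graphE cS' //; apply: contra vS => /eqP e.
    have : v \in [set s; w] by rewrite e !inE eqxx orbT.
    by rewrite !inE => /orP[]/eqP ->.
  by rewrite (negPf profile_free).
have same : color u = color v.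
  have : color u \in color @: (S :\ u) by rewrite full inE.
  case/imsetP => w; rewrite !inE => /andP[wu wS] cuw.
  have [<-//|wv] := eqVneq w v.
  have /color_adj : profile_adj u w.
    apply: cS' => //; first by rewrite eq_sym.
    rewrite set2_eq // !xpair_eqE eqxx /= (negPf wv) /=.
    by rewrite (negPf uv).
  by rewrite cuw eqxx.
have : color u = color v :> nat by rewrite same.
have ur := ltn_pmod u r_gt0; have vr := ltn_pmod v r_gt0.
rewrite !colorE; case: (leqP h u) => hu; case: (leqP h v) => hv /= e.
- by [].
- by rewrite -e ltnn in vr.
- by rewrite e ltnn in ur.
(* The colour [r] also occurs, at one of the last [k] vertices; it is joined to [u] and [v], and its
   neighbours all lie below [b]. *)
have : ord_max \in color @: (S :\ u) by rewrite full inE.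
case/imsetP => w; rewrite !inE => /andP[wu wS] cw.
have hw : h <= w.
  rewrite leqNgt; apply/negP => hw; have := congr1 (@nat_of_ord _) cw.
  by rewrite colorE /= leqNgt hw /= => er; have := ltn_pmod w r_gt0; rewrite -er ltnn.
have lt_b (z : 'I_n) : z < h -> z \in S -> z < b.
  move=> zh zS; have zw : z != w by apply: contraTneq zh => ->; rewrite -leqNgt.
  have : profile_adj z w.
    apply: cS' => //; apply/eqP => ezw.
    have : w \in [set u; v] by rewrite -ezw !inE eqxx orbT.
    by rewrite !inE => /orP[]/eqP ew; move: hw; rewrite ew leqNgt ?hu ?hv.
  case/or3P => [/and3P[_ wh _]|/andP[]//|/andP[_ hz]].
    by rewrite ltnNge hw in wh.
  by rewrite leqNgt zh in hz.
by rewrite !lt_b // e eqxx.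
Qed.

(** [2 * t r b] counts the ordered pairs below [b] with different residues, so moving it to the
    right leaves those with equal residues. The squares include the diagonal, whence only an
    inequality. *)
Lemma fsat_profile_graph :
  2 * fsat r.+2 profile_graph + 2 * t r b <= k ^ 2 + b ^ 2.
Proof.
have kn : k <= n by lia.
have bn : b <= n by lia.
have sS : simple_graph (saturating r.+2 profile_graph).
  by apply/fintype.subsetP => e; rewrite !inE => /andP[/andP[]].
rewrite -(sum_adj sS).
apply: (@leq_trans (\sum_(i < n) \sum_(j < n) ((h <= i) * (h <= j) +
    (i < b) * ((j < b) * (i %% r == j %% r))) + 2 * t r b)).
  rewrite leq_add2r; apply: leq_sum => u _; apply: leq_sum => v _.
  rewrite /adj; case: (boolP (_ \in _)) => // /saturating_color.
  by case/orP => [/andP[-> ->]//|/and3P[-> -> ->]]; rewrite addn1.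
have -> : \sum_(i < n) \sum_(j < n) ((h <= i) * (h <= j) +
    (i < b) * ((j < b) * (i %% r == j %% r))) =
    k * k + \sum_(i < b) \sum_(j < b) (i %% r == j %% r).
  rewrite (eq_bigr (fun i : 'I_n => (h <= i) * k +
    (i < b) * \sum_(j < b) (i %% r == j %% r))) => [|i _].
    rewrite big_split /= (@sum_lt_ord _ _ (fun i => \sum_(j < b) (i %% r == j %% r))) //.
    by rewrite -big_distrl /= sum_ge_ord.
  rewrite big_split /= -!big_distrr /= sum_ge_ord //.
  by rewrite (@sum_lt_ord _ _ (fun j => i %% r == j %% r)).
rewrite double_t -addnA -big_split /= -!mulnn leq_add2l.
rewrite (eq_bigr (fun=> b)) ?sum_nat_const ?card_ord // => i _.
rewrite -big_split (eq_bigr (fun=> 1)) ?sum1_card ?card_ord // => j _ /=.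
by case: (_ == _).
Qed.

End Construction.

Local Open Scope ring_scope.

(** * Weighted sums over edges *)

Section WeightedSum.
Variables (R : realFieldType) (V : finType).
Implicit Types (f : rel V) (a b : V -> R).

Definition wsum f a b : R := \sum_u a u * \sum_v b v * (f u v)%:R.

Lemma wsumDl f a a' b : wsum f (a \+ a') b = wsum f a b + wsum f a' b.
Proof. by rewrite -big_split; apply: eq_bigr => u _ /=; rewrite -mulrDl. Qed.

Lemma wsumDr f a b b' : wsum f a (b \+ b') = wsum f a b + wsum f a b'.
Proof.
rewrite -big_split; apply: eq_bigr => u _ /=; rewrite -mulrDr -big_split.
by congr (_ * _); apply: eq_bigr => v _ /=; rewrite -mulrDl.
Qed.

Lemma wsumC f a b : symmetric f -> wsum f a b = wsum f b a.
Proof.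
move=> fC; rewrite /wsum.
rewrite (eq_bigr (fun u => \sum_v a u * (b v * (f u v)%:R))) => [|u _]; last first.
  by rewrite big_distrr.
rewrite exchange_big; apply: eq_bigr => v _; rewrite big_distrr.
by apply: eq_bigr => u _ /=; rewrite fC mulrCA.
Qed.

Lemma wsum_ge0 f a b : (forall u, 0 <= a u) -> (forall u, 0 <= b u) -> 0 <= wsum f a b.
Proof.
move=> a0 b0; apply: sumr_ge0 => u _; apply: mulr_ge0 => //.
by apply: sumr_ge0 => v _; apply: mulr_ge0.
Qed.

Lemma wsum_sqr f a b : symmetric f -> wsum f (a \+ b) (a \+ b) =
  wsum f a a + 2 * wsum f a b + wsum f b b.
Proof. by move=> fC; rewrite wsumDl !wsumDr [wsum f b a]wsumC //; ring. Qed.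

End WeightedSum.

(** * The Motzkin-Straus inequality *)

Section MotzkinStraus.
Variables (R : realFieldType) (V : finType) (E : {set {set V}}) (r : nat).
Hypotheses (sE : simple_graph E) (r_gt0 : (0 < r)%N).

(* Subtracting from the weights of a largest clique [Q] in the support their
   minimum shrinks the support, and every vertex of the support misses a vertex
   of [Q]. *)
Lemma motzkin_straus (a : V -> R) : (forall u, 0 <= a u) ->
  (forall S, clique E S -> {in S, forall u, 0 < a u} -> (#|S| <= r)%N) ->
  wsum (adj E) a a <= (1 - r%:R^-1) * (\sum_u a u) ^+ 2.
Proof.
have [k] := ubnP #|[set u | 0 < a u]|; elim: k a => // k IH a.
rewrite ltnS => le_k a0 aS.
pose supp S := clique E S && (S \subset [set u | 0 < a u]).
have c0 : supp finset.set0.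
  by rewrite /supp finset.sub0set andbT; apply/cliqueP => u v; rewrite inE.
case: (@arg_maxnP _ finset.set0 supp (fun S => #|S|) c0) => Q /andP[cQ /fintype.subsetP aQ] maxQ.
have aQ0 : {in Q, forall u, 0 < a u} by move=> u /aQ; rewrite inE.
have deg u : 0 < a u -> \sum_(q in Q) (adj E u q)%:R <= #|Q|%:R - 1 :> R.
  move=> u0; rewrite -natr_sum lerBrDr natr1 ler_nat; apply: sum_adj_lt.
  apply/negP => uQ.
  have := maxQ (u |: Q); rewrite /supp clique_cnbr // finset.subUset finset.sub1set inE u0.
  have -> : Q \subset [set u | 0 < a u] by apply/fintype.subsetP.
  by move=> /(_ isT) /=; rewrite cardsU1 (notin_cnbr sE uQ) add1n ltnn.
have [Q0|] := eqVneq Q finset.set0.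
  have au u : a u = 0.
    apply/eqP; rewrite eq_le a0 andbT leNgt; apply/negP => u0.
    have /maxQ : supp [set u].
      rewrite /supp finset.sub1set inE u0 andbT; apply/cliqueP => v w.
      by rewrite !inE => /eqP -> /eqP ->; rewrite eqxx.
    by rewrite Q0 cards1 cards0.
  rewrite /wsum big1 => [|u _]; last by rewrite au mul0r.
  by rewrite big1 ?expr0n ?mulr0.
case/set0Pn => q0 q0Q.
case: (arg_minP a q0Q) => q qQ minq; set m := a q in minq.
have m0 : 0 < m by apply: aQ0.
pose b u := a u - m * (u \in Q)%:R.
pose c u := m * (u \in Q)%:R.
have b0 u : 0 <= b u.
  rewrite /b; case: (boolP (u \in Q)) => [/minq|_]; first by rewrite mulr1 subr_ge0.
  by rewrite mulr0 subr0.
have bca : a = b \+ c by apply/funext => u; rewrite /b /c /= subrK.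
have cE : \sum_u c u = m * #|Q|%:R.
  rewrite -big_distrr /=; congr (_ * _); rewrite -sum1_card natr_sum [RHS]big_mkcond.
  by apply: eq_bigr => u _; case: (u \in Q).
have ba u : b u <= a u.
  by rewrite /b gerBl mulr_ge0 // ltW.
have hb : wsum (adj E) b b <= (1 - r%:R^-1) * (\sum_u b u) ^+ 2.
  apply: IH => // [|S cS bS]; last by apply: aS => // u /bS h; apply: lt_le_trans (ba u).
  apply: leq_trans le_k; apply: proper_card; apply/properP; split.
    apply/fintype.subsetP => u; rewrite !inE => h; exact: lt_le_trans (ba u).
  by exists q; rewrite !inE ?aQ0 // /b (qQ : q \in Q) mulr1 subrr ltxx.
have adjCE : symmetric (adj E) by move=> u v; exact: adjC.
(* All terms of the expansion that involve [c] are bounded at once: a vertex of the support has at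
   most [#|Q| - 1] neighbours in [Q], each of weight [m]. *)
have hc : wsum (adj E) (b \+ b) c + wsum (adj E) c c
    <= m * (#|Q|%:R - 1) * (2 * \sum_u b u + m * #|Q|%:R).
  rewrite -wsumDl -cE big_distrr -big_split big_distrr; apply: ler_sum => u _ /=.
  have -> : b u + b u + c u = 2 * b u + c u by ring.
  rewrite [leRHS]mulrC; have [u0|u0] := ltP 0 (a u).
    apply: ler_wpM2l; first by rewrite addr_ge0 ?mulr_ge0 ?(ltW m0).
    rewrite (eq_bigr (fun v => m * ((v \in Q)%:R * (adj E u v)%:R))) => [|v _].
      rewrite -big_distrr ler_pM2l //=; apply: le_trans (deg u u0).
      rewrite [leRHS]big_mkcond; apply: ler_sum => v _.
      by case: (v \in Q); rewrite ?mul1r ?mul0r.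
    by rewrite /c mulrA.
  have au : a u = 0 by apply/eqP; rewrite eq_le u0 a0.
  have uQ : u \in Q = false by apply/negP => /aQ0; rewrite au ltxx.
  by rewrite /b /c uQ au mulr0 subrr mulr0 addr0 !mul0r.
have s1 : (0 < #|Q|)%N by apply/card_gt0P; exists q.
have sr : (#|Q| <= r)%N by apply: aS.
rewrite bca wsum_sqr // big_split /= cE.
move: hc; rewrite wsumDl => hc.
have r0 : 0 < r%:R :> R by rewrite ltr0n.
have hs : #|Q|%:R - 1 <= (1 - r%:R^-1) * #|Q|%:R :> R.
  rewrite mulrBl mul1r lerD2l lerN2 mulrC ler_pdivrMr // mul1r ler_nat //.
have B0 : 0 <= \sum_u b u by apply: sumr_ge0.
have h2 : 0 <= m * (2 * \sum_u b u + m * #|Q|%:R).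
  by rewrite mulr_ge0 ?addr_ge0 ?mulr_ge0 ?(ltW m0).
have := ler_wpM2l h2 hs; lra.
Qed.

End MotzkinStraus.

(** * Asymptotics of the Turan numbers *)

Section TuranBounds.
Variables (R : realFieldType) (r : nat).
Hypothesis r_gt0 : (0 < r)%N.

(** The Motzkin-Straus inequality for the Turan graph with all weights 1. *)
Lemma t_le n :
  2 * (t r n)%:R <= (1 - r%:R^-1) * n%:R ^+ 2 :> R.
Proof.
have sE := turan_simple r n.
have /= := motzkin_straus sE r_gt0 (fun=> @ler01 R)
  (fun S cS _ => Kfree_clique (turan_free n r_gt0) cS).
rewrite sumr_const card_ord; apply: le_trans.
rewrite -natrM -(sum_adj sE) natr_sum; apply: ler_sum => u _; rewrite mul1r natr_sum.
by apply: ler_sum => v _; rewrite mul1r.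
Qed.

(** Removing [r] vertices by [t_step] changes the quadratic term by exactly the guaranteed
    increment, so the error does not grow beyond that of the base case [n < r]. *)
Lemma t_ge n :
  (1 - r%:R^-1) * n%:R ^+ 2 - r%:R ^+ 2 <= 2 * (t r n)%:R :> R.
Proof.
have r0 : 0 < r%:R :> R by rewrite ltr0n.
have r1 : 1 <= r%:R :> R by rewrite ler1n.
have rV : 0 <= 1 - r%:R^-1 :> R by rewrite subr_ge0 invf_le1.
have rV1 : 1 - r%:R^-1 <= 1 :> R by rewrite gerBl invr_ge0 ltW.
elim/ltn_ind: n => n IH; have [nr|rn] := ltnP n r.
  apply: (@le_trans _ _ 0); last by rewrite mulr_ge0.
  have nr2 : n%:R ^+ 2 <= r%:R ^+ 2 :> R.
    by rewrite ler_sqr ?nnegrE ?ler0n // ler_nat ltnW.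
  rewrite subr_le0; apply: le_trans nr2; rewrite ler_piMl // exprn_ge0 ?ler0n //.
have := t_step r_gt0 (n - r) (leqnn r); rewrite subnK // -(ler_nat R) !natrD !natrM.
rewrite -subn1 natrB // natrB // => h.
have lt : (n - r < n)%N by lia.
have := IH _ lt; rewrite natrB //.
set N := n%:R in h *; set P := r%:R in h r0 r1 *; move=> h2.
have : (1 - P^-1) * N ^+ 2 = (1 - P^-1) * (N - P) ^+ 2 + 2 * ((N - P) * (P - 1)) + P * (P - 1).
  by field; rewrite gt_eqF.
by lra.
Qed.

End TuranBounds.

(** * Maximum fractional packings of cliques *)

Section Packing.
Variables (R : realType) (I V : finType) (P : pred I) (a : I -> V -> bool).

Definition packing (f : I -> R) : Prop :=
  [/\ forall i, 0 <= f i, forall i, ~~ P i -> f i = 0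
    & forall v, \sum_i f i * (a i v)%:R <= 1].

(** Packings form a compact set, on which the total weight attains its maximum. Boundedness comes
    from the hypothesis: an index that covers a vertex has weight at most the capacity 1. *)
Lemma max_packing : (forall i, P i -> exists v, a i v) ->
  exists2 f, packing f & forall g, packing g -> \sum_i g i <= \sum_i f i.
Proof.
move=> aP.
pose ev (w : 'rV[R]_#|I|) i := w ord0 (enum_rank i).
pose ve (f : I -> R) : 'rV[R]_#|I| := \row_j f (enum_val j).
have veK f i : ev (ve f) i = f i by rewrite /ev /ve mxE enum_rankK.
(* The right endpoint is 1 on [P] and 0 elsewhere, so outside [P] the interval is a point. *)
pose box := [set w : 'rV[R]_#|I| |
  forall j, `[0, (P (enum_val j))%:R]%classic (w ord0 j)]%classic.
have cbox : compact box.
  have h := @rV_compact R #|I| (fun j => `[0, (P (enum_val j))%:R]%classic).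
  by apply: h => j; exact: segment_compact.
pose K := [set w | packing (ev w)]%classic.
(* The coefficients [c] cover both the capacity constraints and, with [c = 1], the objective. *)
have sum_cont (c : I -> R) : continuous (fun w => \sum_i ev w i * c i).
  have h := @continuous_big R I +%R 0 predT (@add_continuous _) 'rV[R]_#|I|
    (index_enum I) (fun i w => ev w i * c i).
  apply: h => i _ w.
  have := @cvgMr_tmp R _ _ _ (fun w => ev w i) (ev w i) (c i).
  apply; first exact: nbhs_filter.
  exact: (@coord_continuous R 1 #|I| ord0 (enum_rank i) w).
have KE : K = (box `&` \bigcap_(v in setT)
    [set w | \sum_i ev w i * (a i v)%:R <= 1])%classic.
  apply/seteqP; split => w /=.
    case=> w0 wP w1; split; last by move=> v _ /=.
    move=> j; rewrite /= in_itv /= -[j]enum_valK; move: (enum_val j) => i.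
    rewrite enum_rankK w0 /=; case: (boolP (P i)) => [Pi|/wP]; last by rewrite /ev => ->.
    have [v aiv] := aP i Pi; apply: le_trans (w1 v).
    rewrite (bigD1 i) //= aiv mulr1 lerDl; apply: sumr_ge0 => k _.
    by rewrite mulr_ge0.
  case=> wbox w1; split=> [i|i Pi|v]; last exact: w1.
    by have := wbox (enum_rank i); rewrite /= in_itv /= => /andP[].
  have := wbox (enum_rank i); rewrite /= in_itv /= enum_rankK (negPf Pi).
  by move=> h; apply/eqP; rewrite eq_le andbC.
have cK : compact K.
  apply: (subclosed_compact _ cbox); last by rewrite KE; exact: subIsetl.
  rewrite KE; apply: closedI; first exact: compact_closed.
  apply: closed_bigI => v _; 
  apply: (@preimage_closed _ R (fun w => \sum_i ev w i * (a i v)%:R)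
    [set x : R | x <= 1]%classic); last exact: closed_le.
  by move=> w _; exact: sum_cont.
have K0 : (K !=set0)%classic.
  exists (ve (fun=> 0)); split=> [i|i _|v]; rewrite ?veK //.
  by rewrite big1 // => i _; rewrite veK mul0r.
have [|w wK wmax] := @EVT_max_rV R #|I| (fun w => \sum_i ev w i * 1) K K0 cK.
  exact/continuous_subspaceT/sum_cont.
exists (ev w); first by move: wK; rewrite inE.
move=> g pg; have /wmax : ve g \in K.
  by rewrite inE /K /=; rewrite (_ : ev (ve g) = g) //; apply/funext => i; rewrite veK.
rewrite (eq_bigr g) => [|i _]; last by rewrite veK mulr1.
by rewrite [leRHS](eq_bigr (ev w)) // => i _; rewrite mulr1.
Qed.

End Packing.

Lemma sum_indicator (R : pzSemiRingType) (V : finType) (A : {set V}) :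
  \sum_v (v \in A)%:R = #|A|%:R :> R.
Proof.
by rewrite -sum1_card natr_sum [RHS]big_mkcond; apply: eq_bigr => v _; case: (v \in A).
Qed.

Lemma sum_pred1 (R : pzSemiRingType) (I : finType) (F : I -> R) (i : I) :
  \sum_j (j == i)%:R * F j = F i.
Proof.
rewrite (bigD1 i) //= eqxx mul1r big1 ?addr0 // => j /negPf ->.
by rewrite mul0r.
Qed.

(** Cauchy-Schwarz, from the nonnegativity of the squared deviations from the mean [t]. *)
Lemma sqr_sum_le (R : realFieldType) (I : finType) (A : {set I}) (F : I -> R) :
  (\sum_(i in A) F i) ^+ 2 <= #|A|%:R * \sum_(i in A) F i ^+ 2.
Proof.
have [->|/set0Pn[i0 i0A]] := eqVneq A finset.set0.
  by rewrite big_set0 cards0 mul0r expr0n.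
have c0 : 0 < #|A|%:R :> R by rewrite ltr0n; apply/card_gt0P; exists i0.
set s := \sum_(i in A) F i; set t := s / #|A|%:R.
have : 0 <= \sum_(i in A) (F i - t) ^+ 2 by apply: sumr_ge0 => i _; exact: sqr_ge0.
have -> : \sum_(i in A) (F i - t) ^+ 2
  = \sum_(i in A) F i ^+ 2 - 2 * t * s + #|A|%:R * t ^+ 2.
  rewrite [#|A|%:R * _]mulr_natl -sumr_const /s big_distrr -sumrB -big_split.
  by apply: eq_bigr => i _ /=; ring.
move=> h; have := mulr_ge0 (ltW c0) h.
have -> : #|A|%:R * (\sum_(i in A) F i ^+ 2 - 2 * t * s + #|A|%:R * t ^+ 2)
  = #|A|%:R * (\sum_(i in A) F i ^+ 2) - s ^+ 2.
  by rewrite /t; field; rewrite gt_eqF.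
by rewrite subr_ge0.
Qed.

(** * Consequences of the maximality of a packing *)

Section FractionalPacking.
Variables (R : realType) (V : finType) (E : {set {set V}}) (p : nat).
Hypotheses (sE : simple_graph E) (p_gt1 : (1 < p)%N) (fE : K_free p.+1 E).

Let p_gt0 : (0 < p)%N := ltnW p_gt1.
Let P (Q : {set V}) := clique E Q && (#|Q| == p).
Let mem_set (Q : {set V}) v := v \in Q.

Variable phi : {set V} -> R.
Hypothesis phi_packing : packing P mem_set phi.
Hypothesis phi_max : forall psi : {set V} -> R,
  packing P mem_set psi -> \sum_Q psi Q <= \sum_Q phi Q.

Let phi_ge0 Q : 0 <= phi Q. Proof. by case: phi_packing. Qed.

Let phi_clique Q : 0 < phi Q -> P Q.
Proof. by case: phi_packing => _ h _; case: (boolP (P Q)) => // /h ->; rewrite ltxx. Qed.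

Let k := \sum_Q phi Q.
Let load v : R := \sum_Q phi Q * (v \in Q)%:R.
Let slack v : R := 1 - load v.

Let load_ge0 v : 0 <= load v.
Proof. by apply: sumr_ge0 => Q _; rewrite mulr_ge0. Qed.

Let slack_ge0 v : 0 <= slack v.
Proof. by rewrite subr_ge0; case: phi_packing => _ _; apply. Qed.

Let phi_sum_le (F G : {set V} -> R) :
  (forall Q, P Q -> F Q <= G Q) -> \sum_Q phi Q * F Q <= \sum_Q phi Q * G Q.
Proof.
move=> FG; apply: ler_sum => Q _; have := phi_ge0 Q; rewrite le_eqVlt.
case/orP => [/eqP <-|Q0]; first by rewrite !mul0r.
by rewrite ler_pM2l // FG // phi_clique.
Qed.

Let load_sum : \sum_v load v = p%:R * k.
Proof.
rewrite exchange_big /= mulrC /k big_distrl; apply: eq_bigr => Q _ /=.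
rewrite -big_distrr sum_indicator /=; have := phi_ge0 Q; rewrite le_eqVlt.
case/orP => [/eqP <-|/phi_clique/andP[_ /eqP ->] //]; by rewrite !mul0r.
Qed.

Let slack_sum : \sum_v slack v = #|V|%:R - p%:R * k.
Proof. by rewrite -load_sum sumrB -sum1_card natr_sum. Qed.

Lemma packing_total_le : p%:R * k <= #|V|%:R.
Proof. by rewrite -subr_ge0 -slack_sum sumr_ge0. Qed.

Lemma packing_total_ge1 : contains_K p E -> 1 <= k.
Proof.
case/existsP => Q /andP[szQ cQ]; pose psi (S : {set V}) : R := (S == Q)%:R.
have <- : \sum_S psi S = 1.
  rewrite (eq_bigr (fun S => (S == Q)%:R * 1)) ?sum_pred1 // => S _.
  by rewrite mulr1.
apply: phi_max; split=> [S|S|v]; first exact: ler0n.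
  by rewrite /psi; case: eqP => // ->; rewrite /P cQ szQ.
by rewrite sum_pred1 lern1 leq_b1.
Qed.

(** A clique on [p] vertices, all with slack, could receive their minimum slack as additional
    weight. *)
Lemma slack_clique S : clique E S -> {in S, forall u, 0 < slack u} -> (#|S| <= p.-1)%N.
Proof.
move=> cS S0; rewrite -ltnS prednK //.
have := Kfree_clique fE cS; rewrite leq_eqVlt => /orP[szS|//].
have [q qS] : exists q, q \in S by apply/card_gt0P; rewrite (eqP szS).
case: (arg_minP slack qS) => r rS minr.
pose psi Q := phi Q + (Q == S)%:R * slack r.
have : packing P mem_set psi.
  split=> [Q|Q nQ|v].
  - by rewrite addr_ge0 ?mulr_ge0 // ltW // S0.
  - rewrite /psi; have [_ -> // _] := phi_packing; case: eqP nQ => [->|_ _].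
      by rewrite /P cS szS.
    by rewrite mul0r addr0.
  - rewrite /psi (eq_bigr (fun Q => phi Q * (v \in Q)%:R +
      (Q == S)%:R * (slack r * (v \in Q)%:R))) => [|Q _]; last by rewrite mulrDl mulrA.
    rewrite big_split /= sum_pred1 -/(load v) /=; case: (boolP (v \in S)) => [vS|_].
      by rewrite mulr1 -lerBrDl; apply: minr.
    by rewrite mulr0 addr0 -subr_ge0 slack_ge0.
move/phi_max; rewrite big_split /= sum_pred1 gerDl leNgt S0 //.
Qed.

(* Otherwise replace [Q] by the [p] cliques obtained by exchanging one of its
   vertices for a common neighbour of the others: [p - 1] units of [Q] yield [p]
   units of the new cliques, and only the new vertices are loaded more. *)
Lemma slack_exchange Q : 0 < phi Q ->
  exists2 q, q \in Q & {in cnbr E (Q :\ q), forall u, slack u = 0}.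
Proof.
move=> Q0; have /andP[cQ /eqP szQ] := phi_clique Q0.
apply: contrapT => hQ.
have /choice[u hu] : forall q, exists u, q \in Q ->
    u \in cnbr E (Q :\ q) /\ 0 < slack u.
  move=> q; case: (boolP (q \in Q)) => [qQ|_]; last by exists q.
  apply: contrapT => h; apply: hQ; exists q => // u uq.
  apply/eqP; rewrite eq_le slack_ge0 andbT leNgt; apply/negP => u0.
  by apply: h; exists u.
have [q0 q0Q] : exists q, q \in Q by apply/card_gt0P; rewrite szQ.
case: (arg_minP (slack \o u) q0Q) => r rQ minr.
(* [e] fits into the slack of every replacement vertex, and [e * p <= phi Q] allows [e * (p - 1)] to
   be withdrawn from [Q]. *)
pose e := Num.min (slack (u r)) (phi Q / p%:R).
have pR : 0 < p%:R :> R by rewrite ltr0n.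
have e0 : 0 < e by rewrite lt_min divr_gt0 ?andbT // (hu r rQ).2.
have eQ : e * p%:R <= phi Q by rewrite -ler_pdivlMr // ge_min lexx orbT.
have eu q : q \in Q -> e <= slack (u q).
  by move=> qQ; apply: le_trans (minr q qQ); rewrite ge_min lexx.
pose sw q := u q |: (Q :\ q).
have swP q : q \in Q -> P (sw q).
  move=> qQ; have [uq _] := hu q qQ; rewrite /P /sw.
  rewrite clique_cnbr ?(cliqueW (subsetDl _ _) cQ) //= cardsU1 (notin_cnbr sE uq).
  by rewrite (card_clique_rem szQ qQ) add1n prednK.
pose psi S := phi S + (S == Q)%:R * (- e * (p%:R - 1)) +
  \sum_(q in Q) (S == sw q)%:R * e.
have p1 : 0 <= p%:R - 1 :> R by rewrite subr_ge0 ler1n.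
have : packing P mem_set psi.
  split=> [S|S nS|v].
  - rewrite addr_ge0 ?sumr_ge0 // => [|q _]; last by rewrite mulr_ge0 ?(ltW e0).
    case: eqP => [->|_]; last by rewrite mul0r addr0.
    rewrite mul1r; lra.
  - have [_ /(_ _ nS) h _] := phi_packing; rewrite /psi h add0r.
    rewrite big1 => [|q qQ].
      case: eqP nS => [->|_ _]; last by rewrite mul0r addr0.
      by rewrite phi_clique.
    by case: eqP nS => [->|_ _]; rewrite ?swP // mul0r.
  - have -> : \sum_S psi S * (mem_set S v)%:R =
      load v + - e * (p%:R - 1) * (v \in Q)%:R + e * \sum_(q in Q) (v \in sw q)%:R.
      rewrite /psi (eq_bigr (fun S => phi S * (v \in S)%:R +
        (S == Q)%:R * (- e * (p%:R - 1) * (v \in S)%:R) +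
        \sum_(q in Q) (S == sw q)%:R * (e * (v \in S)%:R))) => [|S _]; last first.
        rewrite !mulrDl; congr (_ + _ + _); first by rewrite -!mulrA.
        by rewrite big_distrl; apply: eq_bigr => q _ /=; rewrite mulrA.
      rewrite !big_split /= sum_pred1; congr (_ + _).
      rewrite exchange_big big_distrr; apply: eq_bigr => q _ /=.
      by rewrite sum_pred1.
    (* A vertex of [Q] survives in [p - 1] of the sets [Q :\ q], which exactly restores the load
       withdrawn from it. *)
    have cnt : \sum_(q in Q) ((v \in Q) && (v != q))%:R = (p%:R - 1) * (v \in Q)%:R :> R.
      case: (boolP (v \in Q)) => [vQ|_]; last by rewrite mulr0 big1.
      rewrite (bigD1 v) //= eqxx add0r mulr1 (eq_bigr (fun=> 1)) => [|q /andP[_ qv]].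
        rewrite sumr_const -szQ (cardsD1 v Q) vQ /= natrD addrC addKr.
        by congr (_ %:R); apply: eq_card => q; rewrite !inE unfold_in /= andbC.
      by rewrite eq_sym qv.
    have le1 : e * \sum_(q in Q) (v \in sw q)%:R <=
      e * ((p%:R - 1) * (v \in Q)%:R) + e * \sum_(q in Q) (v == u q)%:R.
      rewrite -mulrDr ler_pM2l // -cnt -big_split; apply: ler_sum => q _ /=.
      rewrite !inE -natrD ler_nat; case: (v == u q); case: (v \in Q); case: (v == q) => //=.
    (* By disjointness of the common neighbourhoods, [v] is the new vertex of at most one exchanged
       clique. *)
    have le2 : e * \sum_(q in Q) (v == u q)%:R <= slack v.
      case: (boolP [exists q in Q, v == u q]) => [/exists_inP[q qQ /eqP vq]|].
        rewrite (bigD1 q) //= big1 => [|s /andP[sQ sq]].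
          by rewrite vq eqxx addr0 mulr1 eu.
        case: eqP => // vs; have qs : q = s.
          apply: (cnbr_rem_disjoint sE fE cQ szQ qQ sQ (u := v)).
            by rewrite vq; exact: (hu q qQ).1.
          by rewrite vs; exact: (hu s sQ).1.
        by rewrite qs eqxx in sq.
      rewrite negb_exists_in => /forall_inP h.
      by rewrite big1 ?mulr0 // => q /h /negPf ->.
    rewrite -lerBrDl -/(slack v) in le2 *.
    have := le2; rewrite /slack; lra.
move/phi_max; rewrite /psi !big_split /=.
have -> : \sum_S (S == Q)%:R * (- e * (p%:R - 1)) = - e * (p%:R - 1) by rewrite sum_pred1.
have -> : \sum_S \sum_(q in Q) (S == sw q)%:R * e = p%:R * e.
  rewrite exchange_big (eq_bigr (fun=> e)) => [|q _]; last by rewrite sum_pred1.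
  by rewrite sumr_const szQ mulr_natl.
by rewrite -/k; lra.
Qed.

(** * Edges and saturating pairs counted along the packing *)

Let m : R := #|E|%:R.
Let n : R := #|V|%:R.
Let f : R := (fsat p.+1 E)%:R.
Let one : V -> R := fun=> 1.
Let soe := sat_or_eq E p.
Let PR : R := p%:R.

Let adj_sym : symmetric (adj E). Proof. by move=> u v; exact: adjC. Qed.

Let soe_sym : symmetric soe.
Proof. by move=> u v; rewrite /soe /sat_or_eq eq_sym finset.setUC. Qed.

Let wsum_adj_one : wsum (adj E) one one = 2 * m.
Proof.
rewrite -natrM -(sum_adj sE) natr_sum /wsum; apply: eq_bigr => u _.
by rewrite mul1r natr_sum; apply: eq_bigr => v _; rewrite mul1r.
Qed.

Let wsum_soe_one : wsum soe one one = n + 2 * f.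
Proof.
have sS : simple_graph (saturating p.+1 E).
  by apply/fintype.subsetP => e; rewrite !inE => /andP[/andP[]].
rewrite -natrM -(sum_adj sS) natr_sum /n -sum1_card natr_sum -big_split /=.
apply: eq_bigr => u _; rewrite mul1r (bigD1 u) //= /soe /sat_or_eq eqxx mul1r.
congr (_ + _); rewrite natr_sum [RHS](bigD1 u) //= adj_irr // add0r.
by apply: eq_bigr => v vu; rewrite mul1r eq_sym (negPf vu).
Qed.

Let split_one : one = load \+ slack.
Proof. by apply/funext => v; rewrite /= /slack addrC subrK. Qed.

(** Expanding the load over the cliques reduces a bound on the form to one for a single clique. *)
Let load_wsum (g : rel V) b : wsum g load b =
  \sum_Q phi Q * (\sum_v b v * (\sum_(q in Q) (g q v)%:R)).
Proof.
rewrite /wsum (eq_bigr (fun u => \sum_Q phi Q *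
  ((u \in Q)%:R * \sum_v b v * (g u v)%:R))) => [|u _]; last first.
  by rewrite big_distrl; apply: eq_bigr => Q _ /=; rewrite mulrA.
rewrite exchange_big; apply: eq_bigr => Q _ /=; rewrite -big_distrr /=; congr (_ * _).
transitivity (\sum_(u in Q) \sum_v b v * (g u v)%:R).
  rewrite [RHS]big_mkcond; apply: eq_bigr => u _.
  by case: (u \in Q); rewrite ?mul1r ?mul0r.
by rewrite exchange_big; apply: eq_bigr => v _; rewrite big_distrr.
Qed.

Let adj_sum_natr (Q : {set V}) v : \sum_(q in Q) (adj E q v)%:R =
  (\sum_(q in Q) (adj E v q : nat))%:R :> R.
Proof. by rewrite natr_sum; apply: eq_bigr => q _; rewrite adjC. Qed.

(** This is [sum_adj_clique_le] averaged over the packing: [q] itself is a common neighbour of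
    [Q :\ q], so every other one saturates with [q]. *)
Let wsum_load_le b : (forall v, 0 <= b v) ->
  wsum (adj E) load b <= (PR - 2) * k * (\sum_v b v) + wsum soe load b.
Proof.
move=> b0.
have -> : (PR - 2) * k * (\sum_v b v) + wsum soe load b = \sum_Q phi Q *
    (\sum_v b v * (PR - 2 + \sum_(q in Q) (soe q v)%:R)).
  rewrite load_wsum mulrAC mulrC /k big_distrl -big_split; apply: eq_bigr => Q _ /=.
  rewrite -mulrDr; congr (_ * _); rewrite big_distrr -big_split.
  by apply: eq_bigr => v _ /=; rewrite mulrDr; congr (_ + _); rewrite mulrC.
rewrite load_wsum; apply: phi_sum_le => Q /andP[cQ /eqP szQ].
apply: ler_sum => v _; apply: ler_wpM2l => //.
rewrite adj_sum_natr -natrB // -natr_sum -natrD ler_nat subn2.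
apply: leq_trans (sum_adj_clique_le sE p_gt0 fE cQ szQ v) _.
rewrite leq_add2l; apply: leq_sum => q qQ.
case: (boolP (v \in cnbr E (Q :\ q))) => // vq.
by rewrite /soe (cnbr_sat sE p_gt0 fE (cliqueW (subsetDl _ _) cQ)
  (card_clique_rem szQ qQ) (mem_cnbr_rem cQ qQ) vq).
Qed.

Let wsum_load_load : wsum (adj E) load load <= PR * (PR - 1) * k ^+ 2.
Proof.
have -> : PR * (PR - 1) * k ^+ 2 = \sum_Q phi Q * (\sum_v load v * (PR - 1)).
  rewrite -big_distrl /= -big_distrl /= load_sum -/k /PR; ring.
rewrite load_wsum; apply: phi_sum_le => Q /andP[cQ /eqP szQ].
apply: ler_sum => v _; apply: ler_wpM2l => //.
rewrite adj_sum_natr (_ : PR - 1 = p.-1%:R) ?ler_nat; last by rewrite -subn1 natrB.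
exact: sum_adj_clique_lt sE p_gt0 fE Q cQ szQ v.
Qed.

Let wsum_slack_le :
  wsum (adj E) slack slack <= (PR - 2) / (PR - 1) * (n - PR * k) ^+ 2.
Proof.
have p1 : (0 < p.-1)%N by rewrite -subn1 subn_gt0.
have := motzkin_straus sE p1 slack_ge0 slack_clique.
rewrite slack_sum -/n -/PR => h; apply: le_trans h _.
rewrite -subn1 natrB // -/PR.
have PR1 : 1 < PR by rewrite ltr1n.
have -> : 1 - (PR - 1)^-1 = (PR - 2) / (PR - 1) by field; lra.
by [].
Qed.

(* The common neighbourhoods of the [Q :\ q] are disjoint and consist of pairwise
   saturating pairs; by [slack_exchange] only [p - 1] of them carry slack. *)
Let wsum_slack_ge Q (rho : R) : 0 < phi Q -> 0 <= rho ->
  rho + (PR - 2) * (n - PR * k) <= \sum_v slack v * (\sum_(q in Q) (adj E q v)%:R) ->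
  rho ^+ 2 / (PR - 1) <= wsum soe slack slack.
Proof.
move=> Q0 rho0 hrho; have /andP[cQ /eqP szQ] := phi_clique Q0.
have PR1 : 1 < PR by rewrite ltr1n.
pose s q := \sum_v slack v * (v \in cnbr E (Q :\ q))%:R.
have s_rho : rho <= \sum_(q in Q) s q.
  have : \sum_v slack v * (\sum_(q in Q) (adj E q v)%:R) <=
      (PR - 2) * (n - PR * k) + \sum_(q in Q) s q.
    have -> : \sum_(q in Q) s q =
        \sum_v slack v * \sum_(q in Q) (v \in cnbr E (Q :\ q))%:R.
      by rewrite /s exchange_big; apply: eq_bigr => v _; rewrite big_distrr.
    rewrite -slack_sum big_distrr -big_split /=; apply: ler_sum => v _.
    rewrite [(PR - 2) * _]mulrC -mulrDr ler_wpM2l //.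
    rewrite adj_sum_natr -natrB // -natr_sum -natrD ler_nat subn2.
    exact: sum_adj_clique_le sE p_gt0 fE Q cQ szQ v.
  lra.
have s_soe : \sum_(q in Q) s q ^+ 2 <= wsum soe slack slack.
  rewrite (eq_bigr (fun q => \sum_u slack u * \sum_v slack v *
    ((u \in cnbr E (Q :\ q)) && (v \in cnbr E (Q :\ q)))%:R)) => [|q _]; last first.
    rewrite expr2 {1}/s big_distrl; apply: eq_bigr => u _ /=.
    rewrite -mulrA /s big_distrr; congr (_ * _); apply: eq_bigr => v _ /=.
    by case: (u \in cnbr _ _); case: (v \in cnbr _ _); rewrite ?mul1r ?mul0r ?mulr0.
  rewrite exchange_big; apply: ler_sum => u _ /=; rewrite -big_distrr ler_wpM2l //=.
  rewrite exchange_big; apply: ler_sum => v _ /=; rewrite -big_distrr ler_wpM2l //=.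
  case: (boolP [exists q in Q, (u \in cnbr E (Q :\ q)) && (v \in cnbr E (Q :\ q))]).
    case/exists_inP => q qQ /andP[uq vq]; rewrite (bigD1 q) //= uq vq big1 => [|r /andP[rQ rq]].
      by rewrite addr0 /soe (cnbr_sat sE p_gt0 fE (cliqueW (subsetDl _ _) cQ)
        (card_clique_rem szQ qQ) uq vq).
    case: (boolP (u \in cnbr E (Q :\ r))) => //= ur.
    by rewrite (cnbr_rem_disjoint sE fE cQ szQ qQ rQ uq ur) eqxx in rq.
  rewrite negb_exists_in => /forall_inP h.
  by rewrite big1 // => q /h /negPf ->.
have [q0 q0Q hq0] := slack_exchange Q0.
have sq0 : s q0 = 0.
  rewrite /s big1 // => v _; 
  by case: (boolP (v \in cnbr E (Q :\ q0))) => [/hq0 ->|_]; rewrite ?mul0r ?mulr0.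
have rem g : g q0 = 0 -> \sum_(q in Q) g q = \sum_(q in Q :\ q0) g q :> R.
  move=> g0; rewrite (bigD1 q0) //= g0 add0r; apply: eq_bigl => q.
  by rewrite !inE andbC.
have := sqr_sum_le (Q :\ q0) s; rewrite -rem // -rem ?sq0 ?expr0n //.
rewrite (card_clique_rem szQ q0Q) -subn1 natrB // -/PR => hs.
rewrite ler_pdivrMr; last by lra.
rewrite mulrC; apply: le_trans (_ : (PR - 1) * \sum_(q in Q) s q ^+ 2 <= _).
  apply: le_trans hs; rewrite ler_sqr ?nnegrE //.
  exact: le_trans s_rho.
by rewrite ler_pM2l //; lra.
Qed.

(** The estimates add up to [2 k Y - (p - 2) k^2] plus the weight of [soe] inside the slack.
    Dropping that weight gives the first bound; averaging shows it to be at least [rho^2 / (p - 1)]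
    with [rho = Y - (p - 1) k], which completes the square to the second. *)
Lemma packing_saturation (Y : R) : 0 < k ->
    k * Y = m - (PR - 2) / (2 * (PR - 1)) * (n - k) ^+ 2 ->
  2 * k * Y - (PR - 2) * k ^+ 2 <= 2 * f + n /\
  ((PR - 1) * k <= Y -> k ^+ 2 + Y ^+ 2 / (PR - 1) <= 2 * f + n).
Proof.
move=> k0 kY; have PR1 : 1 < PR by rewrite ltr1n.
have hE : 2 * m = wsum (adj E) load load + 2 * wsum (adj E) load slack +
    wsum (adj E) slack slack by rewrite -wsum_adj_one split_one wsum_sqr.
have hS : n + 2 * f = wsum soe load load + 2 * wsum soe load slack +
    wsum soe slack slack by rewrite -wsum_soe_one split_one wsum_sqr.
have h1 := wsum_load_le load_ge0; have h2 := wsum_load_le slack_ge0.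
have h3 := wsum_slack_le; have h4 := wsum_load_load.
rewrite load_sum -/PR in h1; rewrite slack_sum -/PR -/n in h2.
have mE : m = k * Y + (PR - 2) / (2 * (PR - 1)) * (n - k) ^+ 2 by rewrite kY subrK.
set U := (PR - 2) / (PR - 1) in h3.
have UE : U * (PR - 1) = PR - 2 by rewrite /U divfK // gt_eqF //; lra.
have U2 : (PR - 2) / (2 * (PR - 1)) = U / 2 by rewrite /U; field; lra.
rewrite U2 in mE.
have key : wsum soe slack slack + 2 * k * Y - (PR - 2) * k ^+ 2 <= 2 * f + n.
  rewrite -UE in h1 h2 *; lra.
have S0 : 0 <= wsum soe slack slack by apply: wsum_ge0.
split; first by lra.
move=> hY; pose rho := Y - (PR - 1) * k.
have rho0 : 0 <= rho by rewrite subr_ge0.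
suff h : rho ^+ 2 / (PR - 1) <= wsum soe slack slack.
  have : k ^+ 2 + Y ^+ 2 / (PR - 1) =
    rho ^+ 2 / (PR - 1) + 2 * k * Y - (PR - 2) * k ^+ 2.
    by rewrite /rho; field; lra.
  lra.
pose X (Q : {set V}) : R := \sum_v slack v * (\sum_(q in Q) (adj E q v)%:R).
(* The edges between load and slack are what [h3] and [h4] leave of [m]; the left factor is their
   guaranteed weight per unit of packing. *)
have hX : (rho + (PR - 2) * (n - PR * k)) * k <= \sum_Q phi Q * X Q.
  have UE2 : U * (PR - 1) * ((PR - 1) * k ^+ 2) = (PR - 2) * ((PR - 1) * k ^+ 2).
    by rewrite UE.
  rewrite /X -load_wsum /rho -[X in (_ + X * _) * _]UE; lra.
case: (pselect (exists2 Q, 0 < phi Q & rho + (PR - 2) * (n - PR * k) <= X Q)).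
  by case=> Q Q0 hQ; exact: wsum_slack_ge Q0 rho0 hQ.
move=> hno; exfalso; set c := rho + _ in hX hno.
have lt Q : 0 < phi Q -> X Q < c.
  by move=> Q0; rewrite ltNge; apply/negP => h; apply: hno; exists Q.
move: hX; rewrite leNgt => /negP; apply.
rewrite mulrC /k big_distrl /=.
(* A clique of positive weight makes the inequality between the sums strict. *)
have [Q Q0] : exists Q, 0 < phi Q.
  apply: contrapT => h; move: k0; rewrite /k big1 ?ltxx // => Q _.
  by apply/eqP; rewrite eq_le phi_ge0 andbT leNgt; apply/negP => Q0; apply: h; exists Q.
rewrite (bigD1 Q) //= [ltRHS](bigD1 Q) //= ltr_leD ?ltr_pM2l ?lt //.
apply: ler_sum => S _; have := phi_ge0 S; rewrite le_eqVlt.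
case/orP => [/eqP <-|S0']; first by rewrite !mul0r.
by rewrite ler_pM2l // ltW // lt.
Qed.

End FractionalPacking.

Lemma exists_packing_saturation (R : realType) (V : finType) (E : {set {set V}}) p :
    simple_graph E -> (1 < p)%N -> K_free p.+1 E -> contains_K p E ->
  exists k : R, [/\ 1 <= k, p%:R * k <= #|V|%:R & forall Y : R,
    k * Y = #|E|%:R - (p%:R - 2) / (2 * (p%:R - 1)) * (#|V|%:R - k) ^+ 2 ->
    2 * k * Y - (p%:R - 2) * k ^+ 2 <= 2 * (fsat p.+1 E)%:R + #|V|%:R /\
    ((p%:R - 1) * k <= Y ->
     k ^+ 2 + Y ^+ 2 / (p%:R - 1) <= 2 * (fsat p.+1 E)%:R + #|V|%:R)].
Proof.
move=> sE p1 fE cE.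
have [|phi phiP phi_max] := @max_packing R _ _
  (fun Q => clique E Q && (#|Q| == p)) (fun (Q : {set V}) v => v \in Q).
  by move=> Q /andP[_ /eqP szQ]; apply/card_gt0P; rewrite szQ ltnW.
have k1 : 1 <= \sum_Q phi Q by apply: packing_total_ge1 phi_max cE.
exists (\sum_Q phi Q); split=> //; first exact: packing_total_le phiP.
by move=> Y; apply: packing_saturation => //; exact: lt_le_trans k1.
Qed.

(** * The profile function *)

Section Profile.
Variables (R : realType) (p : nat) (lam : R).
Hypotheses (hp : (2 < p)%N) (lam_gt0 : 0 < lam) (lam_le1 : lam <= 1).

Let P : R := p%:R.
(** [T n^2] and [(T + A) n^2] are the leading terms of [t p.-1 n] and of the number of edges at
    ratio [lam]. *)
Let T : R := (P - 2) / (2 * (P - 1)).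
Let A : R := lam / (2 * P * (P - 1)).
Let x := xroot p lam.
Let y := yroot p lam.

Let P3 : 3 <= P. Proof. by rewrite /P ler_nat. Qed.

Let T_gt0 : 0 < T.
Proof. by rewrite /T divr_gt0 //; have := P3; lra. Qed.

Let A_gt0 : 0 < A.
Proof.
rewrite /A divr_gt0 // mulr_gt0 ?mulr_gt0 //; have := P3; lra.
Qed.

Lemma xroot_gt0 : 0 < x.
Proof. by have [] := xroot_spec hp lam_gt0 lam_le1. Qed.

(** This is the edge count [T + A = T (1 - x)^2 + x y], that is, [m = T (n - k)^2 + k Y] rescaled by
    [k = x n] and [Y = y n]. *)
Lemma yroot_constraint : x * y = A + T * (2 * x - x ^+ 2).
Proof.
have x0 := xroot_gt0; have := P3; rewrite /y /yroot -/x -/P /A /T => h.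
by field; rewrite !lt0r_neq0 //; lra.
Qed.

(* The root of the quartic is the critical point of [x^2 + y^2 / (p - 1)] along
   the curve [yroot_constraint]. *)
Lemma yroot_stationary : y * (A + T * x ^+ 2) = (P - 1) * x ^+ 3.
Proof.
have x0 := xroot_gt0; have h := P3.
have [_] := xroot_spec hp lam_gt0 lam_le1; rewrite -/x => hq.
apply/eqP; rewrite -subr_eq0; apply/eqP.
suff -> : y * (A + T * x ^+ 2) - (P - 1) * x ^+ 3
  = - quartic p lam x / (4 * P ^+ 2 * (P - 1) ^+ 2 * x).
  by rewrite hq oppr0 mul0r.
rewrite /y /yroot /quartic /D -/x -/P /A /T.
by field; rewrite !lt0r_neq0 //; lra.
Qed.

Lemma yroot_gt0 : 0 < y.
Proof.
have x0 := xroot_gt0; have h := P3.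
have : 0 < y * (A + T * x ^+ 2).
  by rewrite yroot_stationary mulr_gt0 ?exprn_gt0 //; lra.
by rewrite pmulr_lgt0 // addr_gt0 // mulr_gt0 // exprn_gt0.
Qed.

Lemma Phi2E : 2 * Phi p lam = x ^+ 2 + y ^+ 2 / (P - 1).
Proof. by rewrite /Phi -/x -/y -/P; field; rewrite lt0r_neq0 //; have := P3; lra. Qed.

(* For fixed [y], [z^2 + 2 y w / (p - 1)] is convex in [z] along the curve, with
   critical point [x]. *)
Lemma Phi_le_tangent (z w : R) : 0 < z -> z * w = A + T * (2 * z - z ^+ 2) ->
  2 * Phi p lam <= z ^+ 2 + (2 * y * w - y ^+ 2) / (P - 1).
Proof.
have x0 := xroot_gt0; have y0 := yroot_gt0; have h := P3.
move=> z0 hw.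
have wE : w = (A + T * (2 * z - z ^+ 2)) / z.
  by rewrite -hw mulrAC divff ?mul1r // gt_eqF.
have yE : y = (A + T * (2 * x - x ^+ 2)) / x.
  by rewrite -yroot_constraint mulrAC divff ?mul1r // gt_eqF.
have wy : w - y = (z - x) * (- A / (x * z) - T).
  by rewrite wE yE; field; rewrite !gt_eqF.
(* [yroot_stationary] divided by [(p - 1) x^2]; with it the cofactor of [z - x] below vanishes at
   [z = x], and a square splits off. *)
have yT : y * T / (P - 1) = x - y * A / ((P - 1) * x ^+ 2).
  have -> : y * T / (P - 1)
    = y * (A + T * x ^+ 2) / ((P - 1) * x ^+ 2) - y * A / ((P - 1) * x ^+ 2).
    by field; rewrite !gt_eqF //; lra.
  by rewrite yroot_stationary; congr (_ - _); field; rewrite !gt_eqF //; lra.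
rewrite Phi2E -subr_ge0.
have -> : z ^+ 2 + (2 * y * w - y ^+ 2) / (P - 1) - (x ^+ 2 + y ^+ 2 / (P - 1))
  = z ^+ 2 - x ^+ 2 + 2 * y * (w - y) / (P - 1).
  by field; rewrite gt_eqF //; lra.
have -> : z ^+ 2 - x ^+ 2 + 2 * y * (w - y) / (P - 1)
  = (z - x) * (z + x - 2 * y * A / ((P - 1) * x * z) - 2 * (y * T / (P - 1))).
  by rewrite wy; field; rewrite !gt_eqF //; lra.
rewrite yT.
have -> : (z - x) * (z + x - 2 * y * A / ((P - 1) * x * z)
    - 2 * (x - y * A / ((P - 1) * x ^+ 2)))
  = (z - x) ^+ 2 * (1 + 2 * y * A / ((P - 1) * x ^+ 2 * z)).
  by field; rewrite !gt_eqF //; lra.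
apply: mulr_ge0; first exact: sqr_ge0.
apply: addr_ge0 => //; apply: divr_ge0.
  exact: mulr_ge0 (mulr_ge0 (ler0n _ 2) (ltW y0)) (ltW A_gt0).
by rewrite !mulr_ge0 ?sqr_ge0 ?ltW //; lra.
Qed.

(** Follows from the tangent bound by [w^2 >= 2 y w - y^2]. With [yroot_constraint] and [Phi2E] it
    makes [2 Phi] the minimum along the curve. *)
Lemma Phi_le_curve (z w : R) : 0 < z -> z * w = A + T * (2 * z - z ^+ 2) ->
  2 * Phi p lam <= z ^+ 2 + w ^+ 2 / (P - 1).
Proof.
move=> z0 hw; apply: le_trans (Phi_le_tangent z0 hw) _; have h := P3.
rewrite lerD2l ler_pM2r ?invr_gt0; last by lra.
by have := sqr_ge0 (w - y); rewrite sqrrB; lra.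
Qed.

Lemma T_le_half : T <= 1 / 2.
Proof. by have h := P3; rewrite /T ler_pdivrMr; lra. Qed.

(** Tested at the point [z = 1], [w = A + T <= 1] of the curve. The a priori bounds on [x] and [y]
    come from here. *)
Lemma Phi_le1 : 2 * Phi p lam <= 2.
Proof.
have h := P3; apply: le_trans (Phi_le_curve (z := 1) (w := A + T) ltr01 _) _.
  by rewrite expr1n; ring.
have A1 : A <= 1 / 2.
  have h1 : 1 <= P * (P - 1) by nra.
  have l1 := lam_le1; rewrite /A ler_pdivrMr; lra.
have AT : (A + T) ^+ 2 <= 1.
  have T1 := T_le_half; have A0 := A_gt0; have T0 := T_gt0.
  by rewrite expr_le1 //; lra.
by rewrite expr1n -lerBrDl ler_pdivrMr; lra.
Qed.

Lemma xroot_le2 : x <= 2.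
Proof.
have h := P3; have := Phi_le1; rewrite Phi2E => h2.
have : 0 <= y ^+ 2 / (P - 1) by rewrite divr_ge0 ?sqr_ge0 //; lra.
have := xroot_gt0; nra.
Qed.

Lemma yroot_leP : y <= P.
Proof.
have h := P3; have := Phi_le1; rewrite Phi2E => h2.
have : y ^+ 2 / (P - 1) <= 2 by have := sqr_ge0 x; lra.
rewrite ler_pdivrMr; last by lra.
have := yroot_gt0; nra.
Qed.

(** In the quartic equation the terms with [lam] are nonnegative once moved across. The bound is
    free of [lam], which keeps the final constant dependent on [p] alone. *)
Lemma xroot_ge : 2 * (P - 2) ^+ 2 / (P * D R p) <= x.
Proof.
have h := P3; have x0 := xroot_gt0.
have D0 : 0 < D R p by rewrite /D -/P; nra.
have [_] := xroot_spec hp lam_gt0 lam_le1; rewrite -/x /quartic -/P => hq.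
rewrite ler_pdivrMr; last by rewrite mulr_gt0 //; lra.
have hl : 0 <= 2 * P * (P - 2) * lam * x + lam ^+ 2.
  rewrite addr_ge0 ?sqr_ge0 // !mulr_ge0 ?ltW //; lra.
have : 0 <= (P ^+ 2 * x ^+ 3) * (P * D R p * x - 2 * (P - 2) ^+ 2) by lra.
by rewrite pmulr_rge0 ?mulr_gt0 ?exprn_gt0 //; lra.
Qed.

(** The curve meets the line [w = (p - 1) u] at some [u <= z], where [Phi_le_curve] gives
    [2 Phi <= p u^2]. The right-hand side equals [p u^2] at [u] and does not decrease up to [z],
    because [p z <= 1]. *)
Lemma Phi_le_small (z : R) : 0 < z -> P * z <= 1 ->
  A + T * (2 * z - z ^+ 2) <= (P - 1) * z ^+ 2 ->
  2 * Phi p lam <= 2 * A + 2 * T * (2 * z - z ^+ 2) - (P - 2) * z ^+ 2.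
Proof.
move=> z0 Pz hz; have h := P3.
pose q : {poly R} := (T + P - 1) *: 'X^2 - (2 * T) *: 'X - A%:P.
have qE u : q.[u] = (T + P - 1) * u ^+ 2 - 2 * T * u - A.
  by rewrite /q !hornerE.
have : q.[0] <= 0 <= q.[z].
  rewrite !qE expr0n /= !mulr0 !subr0 sub0r oppr_le0 ltW //=; lra.
case/(poly_ivt (ltW z0)) => u /andP[u0 uz] /rootP; rewrite qE => hu.
have {}u0 : 0 < u.
  rewrite lt_neqAle u0 andbT; apply/eqP => u_eq0; move: hu.
  by rewrite -u_eq0 expr0n /= !mulr0; have := A_gt0; lra.
have := Phi_le_curve (z := u) (w := (P - 1) * u) u0.
move=> /(_ ltac:(lra)).
have -> : u ^+ 2 + ((P - 1) * u) ^+ 2 / (P - 1) = P * u ^+ 2.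
  by field; rewrite gt_eqF //; lra.
move=> hPhi; apply: le_trans hPhi _.
have T2 : 2 * T * (P - 1) = P - 2 by rewrite /T; field; rewrite gt_eqF //; lra.
have : 0 <= (z - u) * (2 * T * (2 - z - u) - (P - 2) * (z + u)).
  apply: mulr_ge0; first by rewrite subr_ge0.
  rewrite -T2.
  have -> : 2 * T * (2 - z - u) - 2 * T * (P - 1) * (z + u)
    = 2 * T * (2 - P * (z + u)) by ring.
  apply: mulr_ge0; first exact: mulr_ge0 (ler0n _ 2) (ltW T_gt0).
  have : P * u <= P * z by rewrite ler_pM2l //; lra.
  by lra.
lra.
Qed.

End Profile.

(** * The two bounds *)

Section LowerBound.
Variables (R : realType) (p : nat) (lam : R).
Hypotheses (hp : (2 < p)%N) (lam_gt0 : 0 < lam) (lam_le1 : lam <= 1).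

Let P : R := p%:R.
Let T : R := (P - 2) / (2 * (P - 1)).
Let A : R := lam / (2 * P * (P - 1)).

(** With [z = k / n], an exact edge count would put [Y / n] at or above the point [w] of the curve;
    since [k >= 1], the edge error [c] lowers [Y] by at most [c]. *)
Lemma Phi_le_packing (n m c k F : R) :
  1 <= n -> 0 <= c -> 1 <= k -> P * k <= n -> n ^+ 2 * (T + A) - c <= m ->
  (forall Y, k * Y = m - T * (n - k) ^+ 2 ->
    2 * k * Y - (P - 2) * k ^+ 2 <= F /\
    ((P - 1) * k <= Y -> k ^+ 2 + Y ^+ 2 / (P - 1) <= F)) ->
  2 * Phi p lam * n ^+ 2 - (3 * c + c ^+ 2) * n <= F.
Proof.
move=> n1 c0 k1 kn hm hY.
have P3 : 3 <= P by rewrite /P ler_nat.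
pose z := k / n; pose w := (A + T * (2 * z - z ^+ 2)) / z.
have n0 : 0 < n by lra.
have k0 : 0 < k by lra.
have z0 : 0 < z by rewrite divr_gt0.
have zn : z * n = k by rewrite /z divfK // gt_eqF.
have zw : z * w = A + T * (2 * z - z ^+ 2) by rewrite /w mulrC divfK // gt_eqF.
pose Y := (m - T * (n - k) ^+ 2) / k.
have kY : k * Y = m - T * (n - k) ^+ 2 by rewrite /Y mulrC divfK // gt_eqF.
have [F1 F2] := hY Y kY.
have kYw : k * (n * w) - c <= k * Y.
  have -> : k * (n * w) = n ^+ 2 * (z * w) by rewrite -zn; ring.
  rewrite zw kY -zn; lra.
have Yw : n * w - c <= Y.
  have : 0 <= k * (Y - n * w) + c by lra.
  have : c <= k * c by rewrite ler_peMl.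
  move=> h1 h2; have : 0 <= k * (Y - n * w + c) by lra.
  by rewrite pmulr_rge0 //; lra.
have c2n : c ^+ 2 <= c ^+ 2 * n by rewrite ler_peMr ?sqr_ge0.
have cn : c <= c * n by rewrite ler_peMr.
have P1 : 0 < P - 1 by lra.
have c2P : c ^+ 2 / (P - 1) <= c ^+ 2.
  by rewrite ler_pdivrMr // ler_peMr ?sqr_ge0 //; lra.
(* Above the line [w = (p - 1) z] the tangent bound applies; being linear in [w], it turns the error
   [c] into [O(c n)]. *)
have [hw|hw] := leP ((P - 1) * z) w.
  set y := yroot p lam.
  have y0 : 0 < y := yroot_gt0 hp lam_gt0 lam_le1.
  have yP : y <= P := yroot_leP hp lam_gt0 lam_le1.
  have hPhi : 2 * Phi p lam <= z ^+ 2 + (2 * y * w - y ^+ 2) / (P - 1).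
    exact: Phi_le_tangent.
  have main : 2 * Phi p lam * n ^+ 2 - 3 * c * n <= k ^+ 2 + Y ^+ 2 / (P - 1).
    have h1 : (2 * (n * y) * (n * w - c) - (n * y) ^+ 2) / (P - 1) <= Y ^+ 2 / (P - 1).
      rewrite ler_pM2r ?invr_gt0 //.
      have := sqr_ge0 (Y - n * y); rewrite sqrrB => h.
      have : 2 * (n * y) * (n * w - c) <= 2 * (n * y) * Y.
        by rewrite ler_pM2l // !mulr_gt0.
      lra.
    have h2 : 2 * Phi p lam * n ^+ 2 <= (z ^+ 2 + (2 * y * w - y ^+ 2) / (P - 1)) * n ^+ 2.
      by rewrite ler_pM2r // exprn_gt0.
    (* From [y <= p] and [p >= 3]; this is the 3 in the error term. *)
    have h3 : 2 * y / (P - 1) <= 3 by rewrite ler_pdivrMr //; lra.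
    have h4 : 2 * y / (P - 1) * (c * n) <= 3 * (c * n).
      by apply: ler_wpM2r => //; rewrite mulr_ge0 // ltW.
    apply: le_trans (_ : k ^+ 2 + (2 * (n * y) * (n * w - c) - (n * y) ^+ 2) / (P - 1) <= _);
      last by rewrite lerD2l.
    rewrite -zn; lra.
  have [hYk|hYk] := leP ((P - 1) * k) Y.
    by have := F2 hYk; have := sqr_ge0 c; lra.
  (* Here only the first bound on [F] is available, but [Y] is within [c] of the threshold, and the
     two bounds differ by [(Y - (p - 1) k)^2 / (p - 1)]. *)
  have hr : (Y - (P - 1) * k) ^+ 2 <= c ^+ 2.
    have : - c <= Y - (P - 1) * k.
      have : (P - 1) * z * n <= w * n by rewrite ler_pM2r.
      by rewrite -mulrA zn; lra.
    by move=> h; nra.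
  have : (Y - (P - 1) * k) ^+ 2 / (P - 1) <= c ^+ 2 / (P - 1).
    by rewrite ler_pM2r ?invr_gt0.
  have : 2 * k * Y - (P - 2) * k ^+ 2 =
    k ^+ 2 + Y ^+ 2 / (P - 1) - (Y - (P - 1) * k) ^+ 2 / (P - 1).
    by field; lra.
  lra.
have hz : A + T * (2 * z - z ^+ 2) <= (P - 1) * z ^+ 2.
  have -> : (P - 1) * z ^+ 2 = z * ((P - 1) * z) by ring.
  by rewrite -zw ler_pM2l // ltW.
have Pz : P * z <= 1 by rewrite /z mulrA ler_pdivrMr // mul1r.
have hPhi : 2 * Phi p lam <= 2 * A + 2 * T * (2 * z - z ^+ 2) - (P - 2) * z ^+ 2.
  exact: Phi_le_small.
have h2 : 2 * Phi p lam * n ^+ 2 <=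
    (2 * A + 2 * T * (2 * z - z ^+ 2) - (P - 2) * z ^+ 2) * n ^+ 2.
  by rewrite ler_pM2r // exprn_gt0.
have : (2 * A + 2 * T * (2 * z - z ^+ 2) - (P - 2) * z ^+ 2) * n ^+ 2
    = 2 * (k * (n * w)) - (P - 2) * k ^+ 2.
  have -> : k * (n * w) = n ^+ 2 * (z * w) by rewrite -zn; ring.
  by rewrite zw -zn; ring.
have := sqr_ge0 c; lra.
Qed.

End LowerBound.

(** * Numerical estimates for the upper bound *)

Section Estimates.
Variables (R : realFieldType) (P n x y c : R).
Hypotheses (P3 : 3 <= P) (n1 : 1 <= n) (x_gt0 : 0 < x) (y_gt0 : 0 < y) (c_gt0 : 0 < c).

Lemma sqr_shift_ge (u v : R) :
  0 <= u -> u <= n -> u - 1 <= v -> 0 <= v -> u ^+ 2 - 2 * n <= v ^+ 2.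
Proof.
move=> u0 un uv v0; have := sqr_ge0 v; have [u1|u1] := leP 1 u.
  have : (u - 1) ^+ 2 <= v ^+ 2 by rewrite ler_sqr ?nnegrE //; lra.
  lra.
nra.
Qed.

(** The surplus [c] in [b] adds [c x n >= (1 + p^2) n] edges, which pays for rounding [k], at most
    [n], and for the error in the Turan number. *)
Lemma profile_edges_ge (T a k b s : R) : 0 <= T -> 2 * T <= 1 ->
  n * x <= k <= n * x + 1 -> n * y + c <= b -> k + b <= n -> 1 + P ^+ 2 <= c * x ->
  x * y = a + T * (2 * x - x ^+ 2) -> 2 * T * (n - k) ^+ 2 - (P - 1) ^+ 2 <= 2 * s ->
  n ^+ 2 * (T + a) <= s + k * b.
Proof.
move=> T0 T1 /andP[k1 k2] b1 kbn cx key hs.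
have hP := P3; have hn := n1; have hx := x_gt0; have hy := y_gt0; have hc := c_gt0.
have nx0 : 0 <= n * x by apply: mulr_ge0 (ltW x_gt0); lra.
have ny0 : 0 <= n * y by apply: mulr_ge0 (ltW y_gt0); lra.
have sq : (n - n * x) ^+ 2 - 2 * n <= (n - k) ^+ 2 by apply: sqr_shift_ge; lra.
have sqT : T * ((n - n * x) ^+ 2 - 2 * n) <= T * (n - k) ^+ 2 by apply: ler_wpM2l.
have Tn : 2 * T * n <= 1 * n by rewrite ler_pM2r //; lra.
have kb : n * x * (n * y + c) <= k * b by apply: ler_pM => //; lra.
have cxn : (1 + P ^+ 2) * n <= c * x * n by rewrite ler_pM2r //; lra.
have P2n : P ^+ 2 <= P ^+ 2 * n by rewrite ler_peMr ?sqr_ge0.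
have P12 : (P - 1) ^+ 2 <= P ^+ 2 by nra.
have keyn : n ^+ 2 * (x * y) = n ^+ 2 * (a + T * (2 * x - x ^+ 2)) by rewrite key.
have := sqr_ge0 P; lra.
Qed.

Let K : R := 5 + 2 * P * (c + 2) + (c + 2) ^+ 2 + P ^+ 2.

Let K_ge : 5 + 2 * P * (c + 1) + (c + 1) ^+ 2 + P ^+ 2 <= K.
Proof. by rewrite /K; have hP := P3; have hc := c_gt0; nra. Qed.

(** Subtracting the Turan number turns [b^2] into [b^2 / (p - 1)] up to a constant; rounding [k] and
    [b] costs [O(n)]. *)
Lemma profile_sat_le (k b s f : R) : x <= 2 -> y <= P ->
  0 <= k <= n * x + 1 -> 0 <= b <= n * y + c + 1 ->
  (1 - (P - 1)^-1) * b ^+ 2 - (P - 1) ^+ 2 <= 2 * s ->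
  2 * f + 2 * s <= k ^+ 2 + b ^+ 2 ->
  2 * f <= (x ^+ 2 + y ^+ 2 / (P - 1)) * n ^+ 2 + K * n.
Proof.
move=> x2 yP /andP[k0 k2] /andP[b0 b2] ht sat.
have hP := P3; have hn := n1; have hx := x_gt0; have hy := y_gt0; have hc := c_gt0.
have r1 : 0 < (P - 1)^-1 by rewrite invr_gt0; lra.
have rP : (P - 1)^-1 <= 1 by rewrite invf_le1; lra.
have hf : 2 * f <= k ^+ 2 + b ^+ 2 / (P - 1) + (P - 1) ^+ 2 by lra.
have k3 : k ^+ 2 <= (n * x + 1) ^+ 2 by rewrite ler_sqr ?nnegrE //; lra.
have b3 : b ^+ 2 <= (n * y + (c + 1)) ^+ 2 by rewrite ler_sqr ?nnegrE //; lra.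
have k4 : (n * x + 1) ^+ 2 <= n ^+ 2 * x ^+ 2 + 5 * n.
  have : n * x <= n * 2 by rewrite ler_pM2l //; lra.
  lra.
set W := 2 * P * (c + 1) + (c + 1) ^+ 2.
have W0 : 0 <= W * n.
  by rewrite /W; apply: mulr_ge0; [apply: addr_ge0; [nra|exact: sqr_ge0]|lra].
have b4 : (n * y + (c + 1)) ^+ 2 / (P - 1) <= n ^+ 2 * (y ^+ 2 / (P - 1)) + W * n.
  have yc : n * y * (c + 1) <= n * P * (c + 1).
    rewrite ler_pM2r; last by lra.
    by rewrite ler_pM2l //; lra.
  have c2 : (c + 1) ^+ 2 <= (c + 1) ^+ 2 * n by rewrite ler_peMr ?sqr_ge0.
  have : (n * y + (c + 1)) ^+ 2 <= n ^+ 2 * y ^+ 2 + W * n by rewrite /W; lra.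
  rewrite -(ler_pM2r r1) mulrDl => hb; apply: le_trans hb _.
  by rewrite mulrA lerD2l ler_piMr.
have b5 : b ^+ 2 / (P - 1) <= (n * y + (c + 1)) ^+ 2 / (P - 1) by rewrite ler_pM2r.
have P2n : P ^+ 2 <= P ^+ 2 * n by rewrite ler_peMr ?sqr_ge0.
have P12 : (P - 1) ^+ 2 <= P ^+ 2 by nra.
have Kn : (5 + W + P ^+ 2) * n <= K * n.
  by rewrite ler_pM2r; [have := K_ge; rewrite /W; lra | lra].
lra.
Qed.

(** If the rounded profile does not fit, then [n (x + y) > n - (c + 2)]. As
    [(x + y)^2 / p <= x^2 + y^2 / (p - 1)], even the count [n^2 / p] for the Turan graph is within
    [O(n)] of the target. *)
Lemma turan_sat_le (s f : R) : n < (n * x + 1) + (n * y + c + 1) ->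
  (1 - P^-1) * n ^+ 2 - P ^+ 2 <= 2 * s -> 2 * f + 2 * s <= n ^+ 2 ->
  2 * f <= (x ^+ 2 + y ^+ 2 / (P - 1)) * n ^+ 2 + K * n.
Proof.
move=> nR ht sat.
have hP := P3; have hn := n1; have hx := x_gt0; have hy := y_gt0; have hc := c_gt0.
have PV : 0 < P^-1 by rewrite invr_gt0; lra.
have PV1 : P^-1 <= 1 by rewrite invf_le1; lra.
have xy : (x + y) ^+ 2 / P <= x ^+ 2 + y ^+ 2 / (P - 1).
  rewrite -subr_ge0.
  have -> : x ^+ 2 + y ^+ 2 / (P - 1) - (x + y) ^+ 2 / P =
    ((P - 1) * x - y) ^+ 2 / (P * (P - 1)) by field; lra.
  by rewrite divr_ge0 ?sqr_ge0 // mulr_ge0; lra.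
have xyn : n ^+ 2 - 2 * n * (c + 2) <= n ^+ 2 * (x + y) ^+ 2.
  have hs : n - (c + 2) <= n * (x + y) by lra.
  rewrite -exprMn; set z := n * (x + y) in hs *.
  have := sqr_ge0 (c + 2); have := sqr_ge0 z.
  have [nc|nc] := leP (c + 2) n.
    have : (n - (c + 2)) ^+ 2 <= z ^+ 2 by rewrite ler_sqr ?nnegrE //; lra.
    lra.
  have : n * (n - 2 * (c + 2)) <= 0 by rewrite mulr_ge0_le0 //; lra.
  lra.
have f1 : 2 * f <= n ^+ 2 * P^-1 + P ^+ 2 by lra.
have f2 : n ^+ 2 * P^-1 - 2 * n * (c + 2) * P^-1 <= n ^+ 2 * ((x + y) ^+ 2 / P).
  by rewrite mulrA -mulrBl ler_pM2r.
have f3 : n ^+ 2 * ((x + y) ^+ 2 / P) <= n ^+ 2 * (x ^+ 2 + y ^+ 2 / (P - 1)).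
  by rewrite ler_wpM2l ?sqr_ge0.
have f4 : 2 * n * (c + 2) * P^-1 <= 2 * n * (c + 2).
  by rewrite ler_piMr // !mulr_ge0 //; lra.
have P2n : P ^+ 2 <= P ^+ 2 * n by rewrite ler_peMr ?sqr_ge0.
have Kn : (2 * (c + 2) + P ^+ 2) * n <= K * n.
  by rewrite ler_pM2r; [rewrite /K; nra | lra].
lra.
Qed.

End Estimates.

(** * Both bounds for given [n] and [m] *)

Section Bounds.
Variables (R : realType) (p : nat).
Hypothesis hp : (2 < p)%N.

Let P : R := p%:R.
Let T : R := (P - 2) / (2 * (P - 1)).
Let A (lam : R) : R := lam / (2 * P * (P - 1)).

Let p_gt0 : (0 < p)%N. Proof. by lia. Qed.
Let p_gt1 : (1 < p)%N. Proof. by lia. Qed.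
Let pred_gt0 : (0 < p.-1)%N. Proof. by lia. Qed.
Let prednE : p.-1.+1 = p. Proof. by lia. Qed.

Let P3 : 3 <= P. Proof. by rewrite /P ler_nat. Qed.

Let predP : p.-1%:R = P - 1 :> R.
Proof. by rewrite -subn1 natrB. Qed.

Let T_pred : 1 - p.-1%:R^-1 = 2 * T :> R.
Proof. by rewrite predP /T; have h := P3; field; lra. Qed.

Let T_lam lam : (1 - lam) * (1 - p.-1%:R^-1) + lam * (1 - P^-1) = 2 * (T + A lam).
Proof. by rewrite T_pred /A /T; have h := P3; field; lra. Qed.

Let T_ge0 : 0 <= T. Proof. by rewrite /T divr_ge0 //; have := P3; lra. Qed.

Let T_le : 2 * T <= 1.
Proof. by rewrite -T_pred gerBl invr_ge0 predP; have := P3; lra. Qed.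

Section FixedSize.
Variables n m : nat.
Hypotheses (n_gt0 : (0 < n)%N) (hm : (t p.-1 n < m <= t p n)%N).

Let lam : R := (m%:R - (t p.-1 n)%:R) / ((t p n)%:R - (t p.-1 n)%:R).

Let tt_gt0 : 0 < (t p n)%:R - (t p.-1 n)%:R :> R.
Proof. by case/andP: hm => h1 h2; rewrite subr_gt0 ltr_nat; apply: leq_trans h2. Qed.

Lemma turan_ratio_gt0 : 0 < lam.
Proof. by case/andP: hm => h1 _; rewrite divr_gt0 // subr_gt0 ltr_nat. Qed.

Lemma turan_ratio_le1 : lam <= 1.
Proof. by case/andP: hm => _ h2; rewrite ler_pdivrMr // mul1r lerD2r ler_nat. Qed.

Let mE : m%:R = (1 - lam) * (t p.-1 n)%:R + lam * (t p n)%:R.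
Proof. by rewrite /lam; field; rewrite gt_eqF. Qed.

Let n1 : 1 <= n%:R :> R. Proof. by rewrite ler1n. Qed.

Let m_ge : n%:R ^+ 2 * (T + A lam) - P ^+ 2 <= m%:R.
Proof.
have h1 : (1 - lam) * ((1 - p.-1%:R^-1) * n%:R ^+ 2 - p.-1%:R ^+ 2) <=
    (1 - lam) * (2 * (t p.-1 n)%:R).
  by apply: ler_wpM2l (t_ge R pred_gt0 n); rewrite subr_ge0 turan_ratio_le1.
have h2 : lam * ((1 - P^-1) * n%:R ^+ 2 - P ^+ 2) <= lam * (2 * (t p n)%:R).
  by apply: ler_wpM2l (t_ge R p_gt0 n); rewrite ltW // turan_ratio_gt0.
have h3 : (1 - lam) * p.-1%:R ^+ 2 <= (1 - lam) * P ^+ 2.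
  apply: ler_wpM2l; first by rewrite subr_ge0 turan_ratio_le1.
  by rewrite predP; have := P3; nra.
have h4 : n%:R ^+ 2 * ((1 - lam) * (1 - p.-1%:R^-1) + lam * (1 - P^-1)) =
  n%:R ^+ 2 * (2 * (T + A lam)) by rewrite T_lam.
have := sqr_ge0 P; rewrite mE; lra.
Qed.

Let m_le : m%:R <= n%:R ^+ 2 * (T + A lam).
Proof.
have h1 : (1 - lam) * (2 * (t p.-1 n)%:R) <= (1 - lam) * ((1 - p.-1%:R^-1) * n%:R ^+ 2).
  by apply: ler_wpM2l (t_le R pred_gt0 n); rewrite subr_ge0 turan_ratio_le1.
have h2 : lam * (2 * (t p n)%:R) <= lam * ((1 - P^-1) * n%:R ^+ 2).
  by apply: ler_wpM2l (t_le R p_gt0 n); rewrite ltW // turan_ratio_gt0.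
have h4 : n%:R ^+ 2 * ((1 - lam) * (1 - p.-1%:R^-1) + lam * (1 - P^-1)) =
  n%:R ^+ 2 * (2 * (T + A lam)) by rewrite T_lam.
rewrite mE; lra.
Qed.

Lemma fsat_lower (E : {set {set 'I_n}}) : Kfree_graph p.+1 m E ->
  2 * Phi p lam * n%:R ^+ 2 - (3 * P ^+ 2 + (P ^+ 2) ^+ 2 + 1) * n%:R <=
  2 * (fsat p.+1 E)%:R.
Proof.
case/and3P => sE fE /eqP szE.
have cE : contains_K p E.
  apply: contraT => fE'; case/andP: hm; rewrite -szE ltnNge => /negP[].
    rewrite -[X in (_ <= t _ X)%N](card_ord n); apply: turan_theorem => //.
  by rewrite prednE.
have [k [k1 kn hY]] := exists_packing_saturation R sE p_gt1 fE cE.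
rewrite card_ord szE in kn hY.
(* The edge error is [p^2], by [m_ge]; the additional 1 in the claim absorbs the summand [n] of the
   packing bound. *)
have := Phi_le_packing hp turan_ratio_gt0 turan_ratio_le1 n1 (sqr_ge0 P) k1 kn m_ge hY.
lra.
Qed.

Lemma fsat_min_le_sub (F : {set {set 'I_n}}) :
  simple_graph F -> K_free p.+1 F -> (m <= #|F|)%N ->
  (fsat_min p.+1 n m <= fsat p.+1 F)%N.
Proof.
move=> sF fF le_m.
have : (0 < #|[set E : {set {set 'I_n}} | E \subset F & #|E| == m]|)%N.
  by rewrite cards_draws bin_gt0.
case/card_gt0P => E; rewrite inE => /andP[EF szE].
apply: leq_trans (fsat_mono EF fF); apply: fsat_min_le.
rewrite /Kfree_graph szE andbT /simple_graph (fintype.subset_trans EF sF) /=.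
apply: contra fF => /existsP[S /andP[szS /forallP cS]].
apply/existsP; exists S; rewrite szS; apply/forallP => e.
apply/implyP => e2; apply/implyP => eS; apply: (fintype.subsetP EF).
by have := cS e; rewrite e2 eS.
Qed.

Let x := xroot p lam.
Let y := yroot p lam.
(** Divided by the lower bound of [xroot_ge] instead of [x], so that [1 + p^2 <= c x] holds for a
    [c] independent of [lam]. *)
Let c : R := (1 + P ^+ 2) / (2 * (P - 2) ^+ 2 / (P * D R p)).
Let K : R := 5 + 2 * P * (c + 2) + (c + 2) ^+ 2 + P ^+ 2.

Let x0 : 0 < x := xroot_gt0 hp (turan_ratio_gt0) (turan_ratio_le1).
Let y0 : 0 < y := yroot_gt0 hp turan_ratio_gt0 turan_ratio_le1.
Let x2 : x <= 2 := xroot_le2 hp turan_ratio_gt0 turan_ratio_le1.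
Let yP : y <= P := yroot_leP hp turan_ratio_gt0 turan_ratio_le1.

Let D0 : 0 < D R p. Proof. by rewrite /D -/P; have := P3; nra. Qed.

Let xmin_gt0 : 0 < 2 * (P - 2) ^+ 2 / (P * D R p).
Proof.
by rewrite divr_gt0 ?mulr_gt0 ?exprn_gt0 //; have := P3; lra.
Qed.

Let c0 : 0 < c.
Proof. by apply: divr_gt0 xmin_gt0; have := sqr_ge0 P; lra. Qed.

Let cx : 1 + P ^+ 2 <= c * x.
Proof.
rewrite /c mulrAC ler_pdivlMr ?xmin_gt0 //; apply: ler_wpM2l.
  by have := sqr_ge0 P; lra.
exact: xroot_ge hp turan_ratio_gt0 turan_ratio_le1.
Qed.

(** Both sizes are rounded up, so that the graph has at least [m] edges; [fsat_min_le_sub] discards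
    the surplus. *)
Let k := (Num.truncn (n%:R * x)).+1.
Let b := (Num.truncn (n%:R * y + c)).+1.

Let kP : n%:R * x <= k%:R <= n%:R * x + 1.
Proof.
have /truncn_itv/andP[h1 h2] : 0 <= n%:R * x by rewrite mulr_ge0 // ltW.
by rewrite (ltW h2) /k -natr1 lerD2r.
Qed.

Let bP : n%:R * y + c <= b%:R <= n%:R * y + c + 1.
Proof.
have /truncn_itv/andP[h1 h2] : 0 <= n%:R * y + c.
  by apply: addr_ge0 (ltW c0); apply: mulr_ge0 (ltW y0).
by rewrite (ltW h2) /b -natr1 lerD2r.
Qed.

Let upper_profile : (k + b <= n)%N ->
  2 * (fsat_min p.+1 n m)%:R <= 2 * Phi p lam * n%:R ^+ 2 + K * n%:R.
Proof.
move=> kbn; have free := profile_free pred_gt0 kbn.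
have sat := fsat_profile_graph pred_gt0 kbn.
rewrite prednE in free sat.
have sG := @profile_simple n k b p.-1.
have le_m : (m <= #|profile_graph n k b p.-1|)%N.
  rewrite card_profile_graph // -(ler_nat R) natrD natrM; apply: le_trans m_le _.
  have := t_ge R pred_gt0 (n - k).
  rewrite T_pred natrB ?(leq_trans (leq_addr _ _) kbn) // predP => ht.
  apply: (profile_edges_ge P3 n1 x0 y0 c0 T_ge0 T_le kP) cx _ ht.
  - by case/andP: bP.
  - by rewrite -natrD ler_nat.
  - exact: yroot_constraint hp turan_ratio_gt0 turan_ratio_le1.
have le_f := fsat_min_le_sub sG free le_m.
have ht := t_ge R pred_gt0 b; rewrite predP in ht.
have hk : 0 <= (k%:R : R) <= n%:R * x + 1 by rewrite ler0n; case/andP: kP.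
have hb : 0 <= (b%:R : R) <= n%:R * y + c + 1 by rewrite ler0n; case/andP: bP.
rewrite (Phi2E _ hp); apply: (profile_sat_le P3 n1 x0 y0 c0 x2 yP hk hb ht).
rewrite -!natrX -!natrM -!natrD ler_nat; apply: leq_trans sat.
by rewrite leq_add2r leq_mul2l.
Qed.

Let upper_turan : (n < k + b)%N ->
  2 * (fsat_min p.+1 n m)%:R <= 2 * Phi p lam * n%:R ^+ 2 + K * n%:R.
Proof.
move=> nkb; have le_m : (m <= #|turan p n|)%N by case/andP: hm.
have le_f := fsat_min_le_sub (turan_simple p n) (turan_free n p_gt0) le_m.
(* All non-edges of the Turan graph are counted here, saturating or not. *)
have sat := fsat_add_card_le p.+1 (turan_simple p n).
rewrite (Phi2E _ hp); apply: (turan_sat_le P3 n1 x0 y0 c0 _ (t_ge R p_gt0 n)).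
  have [_ k2] := andP kP; have [_ b2] := andP bP.
  by apply: lt_le_trans (lerD k2 b2); rewrite -natrD ltr_nat.
rewrite -!natrX -!natrM -!natrD ler_nat -mulnDr.
apply: leq_trans (_ : 2 * 'C(n, 2) <= _)%N.
  by rewrite leq_mul2l; apply: leq_trans sat; rewrite leq_add2r.
rewrite bin2 -mulnn mul2n; apply: leq_trans (_ : n * n.-1 <= _)%N.
  by rewrite -[leqRHS]odd_double_half leq_addl.
by rewrite leq_mul2l leq_pred orbT.
Qed.

Lemma fsat_upper :
  2 * (fsat_min p.+1 n m)%:R <= 2 * Phi p lam * n%:R ^+ 2 + K * n%:R.
Proof. by have [/upper_profile|/upper_turan] := leqP (k + b) n. Qed.

End FixedSize.
End Bounds.

Theorem theorem1p3 (R : realType) (p : nat) (hp : (3 <= p)%N) :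
  exists C : R, forall n m : nat,
    (1 <= n)%N -> (t p.-1 n < m <= t p n)%N ->
    let lam : R :=
      (m%:R - (t p.-1 n)%:R) / ((t p n)%:R - (t p.-1 n)%:R) in
    `| (fsat_min p.+1 n m)%:R - Phi p lam * n%:R ^+ 2 | <= C * n%:R.
Proof.
pose P : R := p%:R.
pose c : R := (1 + P ^+ 2) / (2 * (P - 2) ^+ 2 / (P * D R p)).
pose K : R := 5 + 2 * P * (c + 2) + (c + 2) ^+ 2 + P ^+ 2.
pose L : R := 3 * P ^+ 2 + (P ^+ 2) ^+ 2 + 1.
exists (Num.max K L) => n m n1 hm /=.
set lam := (X in Phi p X).
have p0 : (0 < p)%N by lia.
have [_ le_m] := andP hm.
have [E0 hE0] := Kfree_graph_ex p0 le_m.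
have [E hE fE] := fsat_min_attained hE0.
have lo := fsat_lower R hp n1 hm hE; rewrite fE in lo.
have up := fsat_upper R hp n1 hm.
rewrite -/P -/lam -/L in lo; rewrite -/P -/c -/K -/lam in up.
have Kn : K * n%:R <= Num.max K L * n%:R by rewrite ler_wpM2r // le_max lexx.
have Ln : L * n%:R <= Num.max K L * n%:R by rewrite ler_wpM2r // le_max lexx orbT.
have n0 : 0 <= n%:R :> R by [].
(* [lo] and [up] concern twice the quantity; nonnegativity lets the halved errors be bounded by the
   full ones. *)
have L0 : 0 <= L * n%:R.
  by rewrite mulr_ge0 // !addr_ge0 ?mulr_ge0 ?sqr_ge0.
rewrite ler_norml; apply/andP; split; lra.
Qed.
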